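(* Consider a mass migration process on $\mathbb Z^d$ with generator $\mathcal L$, whose rates satisfy: there is $C>0$ such that $\sum_{k=1}^{\alpha}k\,g^k_{\alpha,\beta}\le C(\alpha+\beta)$ for all $\alpha>0,\beta\ge0$. Let $\bar\mu$ be a translation-invariant product probability measure on $\mathbb N^{\mathbb Z^d}$ whose single site marginal $\mu$ has a finite first moment $\|\mu\|_1=\sum_{n\in\mathbb N}n\mu(n)$. For all $\alpha,\beta\ge0$ let $$\mathbf A(\alpha,\beta)=\sum_{k\le\beta}g^k_{\alpha+k,\beta-k}\frac{\mu(\alpha+k)\mu(\beta-k)}{\mu(\alpha)\mu(\beta)}-\sum_{k\le\alpha}g^k_{\alpha,\beta}\quad\text{if }\mu(\alpha)\mu(\beta)\ne0,$$ and $\mathbf A(\alpha,\beta)=0$ otherwise. Consider the conditions: (1) $\sum_{k\le\beta}g^k_{\alpha+k,\beta-k}\,\mu(\alpha+k)\mu(\beta-k)=0$ for all $\alpha,\beta\ge0$ such that $\mu(\alpha)\mu(\beta)=0$; (2) $\mathbf A(\alpha,\beta)=-\mathbf A(\beta,\alpha)$ for all $\alpha,\beta\ge0$; (3) there exists a function $\psi$ on $\mathbb N$ such that $\mathbf A(\alpha,\beta)=\psi(\beta)-\psi(\alpha)$ for all $\alpha,\beta\ge0$ such that $\mu(\alpha)\mu(\beta)\neq0$. Then (1) combined with (2) is a necessary condition for $\bar\mu$ to be invariant for the process. If $p(\cdot,\cdot)$ is symmetric, (1) and (2) together are also sufficient. If $p(\cdot,\cdot)$ is asymmetric, $\bar\mu$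 is invariant for the process if and only if (1) and (3) hold.
   Context: $\mathbb N=\{0,1,2,\dots\}$ and $X=\mathbb Z^d$. Mass migration process (MMP): $p(\cdot,\cdot)$ is an irreducible translation-invariant transition probability on $\mathbb Z^d$ (symmetric if $p(x,y)=p(y,x)$ for all $x,y$, asymmetric otherwise). The rates are numbers $g^k_{\alpha,\beta}\ge0$ ($k,\alpha,\beta\in\mathbb N$) with $g^0_{\alpha,\beta}=0$ and $g^k_{\alpha,\beta}=0$ if $k>\alpha$ or $\alpha=0$ (so sums over $k\le\alpha$ effectively start at $k=1$); $k$ particles jump together from $x$ to $y$ at rate $p(x,y)g^k_{\eta(x),\eta(y)}$. Fix a positive function $a$ on $X$ and $M>0$ with $\sum_yp(x,y)a_y+\sum_ya_yp(y,x)\le Ma_x$ for all $x$, and $\sum_xa_x<\infty$. Set $\|\eta\|=\sum_x\eta(x)a_x$, $\|\eta-\zeta\|=\sum_x|\eta(x)-\zeta(x)|a_x$, $\mathfrak X=\{\eta\in\mathbb N^X:\|\eta\|<\infty\}$, and let $\mathbf L$ be the set of $f:\mathfrak X\to\mathbb R$ such that $|f(\eta)-f(\zeta)|\le L_f\|\eta-\zeta\|$ for some $L_f>0$ and all $\eta,\zeta\in\mathfrak X$. Generator: $\mathcal Lf(\eta)=\sum_{x,y\in X}\sum_{k>0}p(x,y)g^k_{\eta(x),\eta(y)}\big(f(\mathcal S^k_{x,y}\eta)-f(\eta)\big)$ for $f\in\mathbf L$, $\eta\in\mathfrak X$, where $\mathcal S^k_{x,y}\eta$ is $\eta$ with $k$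 particles moved from $x$ to $y$ if $\eta(x)\ge k$ and $x\neq y$, and $\mathcal S^k_{x,y}\eta=\eta$ otherwise. The process is assumed constructed, i.e. there is a Markov semigroup $(S(t))_{t\ge0}$ on $\mathbf L$ such that for $f\in\mathbf L$, $\eta\in\mathfrak X$: $S(t_1+t_2)=S(t_1)S(t_2)$, $S(0)=I$; $S(t)f(\eta)=f(\eta)+\int_0^t\mathcal LS(s)f(\eta)\,ds$; $|S(t)f(\eta)-f(\eta)|\le\|\eta\|L_f(e^{ct}-1)$ for a constant $c>0$; $S(t)f(\eta)$ and $\mathcal LS(t)f(\eta)$ are continuous in $t$; $\lim_{t\searrow0}(S(t)f(\eta)-f(\eta))/t=\mathcal Lf(\eta)$; $\mathcal LS(t)f(\eta)=S(t)\mathcal Lf(\eta)$. A probability measure $\bar\mu$ on $\mathbb N^X$ is invariant for the process if it is supported on $\mathfrak X$ and $\int S(t)f\,d\bar\mu=\int f\,d\bar\mu$ for every bounded $f\in\mathbf L$ and every $t\ge0$. *)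

(* Defs.v *)
From HB Require Import structures.
From mathcomp Require Import all_boot all_order all_algebra.
From mathcomp Require Import all_classical all_reals all_analysis.

Set Implicit Arguments.
Unset Strict Implicit.
Unset Printing Implicit Defensive.
Import Order.TTheory GRing.Theory Num.Theory.
Import numFieldNormedType.Exports.

Local Open Scope classical_set_scope.
Local Open Scope ring_scope.

Notation site d := 'rV[int]_d.

(* Unconditional sum of a real family. It is the usual sum when the family is
   absolutely summable on D; otherwise its value is irrelevant. *)
Definition rsum (R : realType) (I : choiceType) (D : set I) (u : I -> R) : R :=
  fine (esum D (EFin \o u)^\+ - esum D (EFin \o u)^\-)%E.

Section transition_probabilities.
Context {R : realType} {d : nat}.
Implicit Types (p : site d -> site d -> R) (x y z : site d).

Definition transition_probability p : Prop :=
  (forall x y, 0 <= p x y) /\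
  (forall x, \esum_(y in [set: site d]) (p x y)%:E = 1%E).

Definition translation_invariant p : Prop :=
  forall x y z, p (x + z) (y + z) = p x y.

Fixpoint step_probability p (n : nat) x y : \bar R :=
  if n is m.+1 then
    (\esum_(z in [set: site d]) ((p x z)%:E * step_probability p m z y))%E
  else (x == y)%:R%:E.

Definition irreducible p : Prop :=
  forall x y, exists n, (0 < step_probability p n x y)%E.

Definition symmetric_kernel p : Prop := forall x y, p x y = p y x.

End transition_probabilities.

(* g k alpha beta stands for g^k_{alpha,beta}. *)
Definition mmp_rates (R : realType) (g : nat -> nat -> nat -> R) : Prop :=
  [/\ forall k alpha beta, 0 <= g k alpha beta,
      forall alpha beta, g 0%N alpha beta = 0 &
      forall k alpha beta, (alpha < k)%N \/ alpha = 0%N -> g k alpha beta = 0].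

Definition linear_growth (R : realType) (g : nat -> nat -> nat -> R) : Prop :=
  exists2 C : R, 0 < C & forall alpha beta : nat, (0 < alpha)%N ->
    \sum_(1 <= k < alpha.+1) k%:R * g k alpha beta <= C * (alpha + beta)%:R.

Definition config (d : nat) := site d -> nat.

Definition jump {d : nat} (k : nat) (x y : site d) (eta : config d)
    : config d :=
  if (k <= eta x)%N && (x != y) then
    fun z => if z == x then (eta x - k)%N
             else if z == y then (eta y + k)%N else eta z
  else eta.

Section finite_norm.
Context {R : realType} {d : nat}.
Implicit Types (a : site d -> R) (p : site d -> site d -> R).

Definition weight p a : Prop :=
  [/\ forall x, 0 < a x,
      exists2 M : R, 0 < M & forall x,
        (\esum_(y in [set: site d]) (p x y * a y)%:E +
         \esum_(y in [set: site d]) (a y * p y x)%:E <= (M * a x)%:E)%E &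
      (\esum_(x in [set: site d]) (a x)%:E < +oo)%E].

Definition cnorm a (eta : config d) : \bar R :=
  \esum_(x in [set: site d]) ((eta x)%:R * a x)%:E.

Definition cdist a (eta zeta : config d) : \bar R :=
  \esum_(x in [set: site d]) (`|(eta x)%:R - (zeta x)%:R| * a x)%:E.

Definition finite_norm a : set (config d) := [set eta | (cnorm a eta < +oo)%E].

Lemma finite_norm_jump a k x y (eta : config d) : (forall x, 0 < a x) ->
  finite_norm a eta -> finite_norm a (jump k x y eta).
Proof.
move=> a0; rewrite /finite_norm /= => eta_fin.
rewrite /jump; case: ifP => // _.
pose b z : \bar R := (if z == y then k%:R * a y else 0)%:E.
have b0 z : (0 <= b z)%E.
  by rewrite lee_fin; case: ifP => // _; rewrite mulr_ge0// ltW.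
have e0 z : (0 <= ((eta z)%:R * a z)%:E)%E by rewrite lee_fin mulr_ge0// ltW.
apply: (@le_lt_trans _ _
    (\esum_(z in [set: site d]) (((eta z)%:R * a z)%:E + b z))%E).
  apply: le_esum => z _; rewrite -EFinD lee_fin.
  have [->|zx] := eqVneq z x.
    rewrite (@le_trans _ _ ((eta x)%:R * a x))//.
      by rewrite ler_wpM2r ?ler_nat ?leq_subr// ltW.
    by have := b0 x; rewrite lee_fin => bx0; rewrite lerDl.
  have [->|zy] := eqVneq z y; first by rewrite natrD mulrDl.
  by rewrite addr0.
rewrite esumD//; apply: lte_add_pinfty => //.
rewrite (esumID [set y])//= setTI [X in (_ + X)%E]esum1 ?adde0; last first.
  by move=> z [_ /= /eqP zy]; rewrite /b (negbTE zy).
by rewrite esum_set1// ltry.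
Qed.

End finite_norm.

Notation state a := (set_type (finite_norm a)).

Section semigroup.
Context {R : realType} {d : nat}.
Implicit Types (a : site d -> R) (p : site d -> site d -> R).

(* The default value of insubd is never used for a positive weight, see
   val_sjump. *)
Definition sjump {a} (k : nat) (x y : site d) (eta : state a) : state a :=
  insubd eta (jump k x y (val eta)).

Lemma val_sjump a k x y (eta : state a) : (forall x, 0 < a x) ->
  val (sjump k x y eta) = jump k x y (val eta).
Proof.
move=> a0; rewrite val_insubd mem_set//.
by apply: finite_norm_jump => //; exact: set_valP.
Qed.

Definition lipschitz_with {a} (l : R) (f : state a -> R) : Prop :=
  0 < l /\ forall eta zeta : state a,
    (`|f eta - f zeta|%:E <= l%:E * cdist a (val eta) (val zeta))%E.

Definition Lip {a} (f : state a -> R) : Prop :=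
  exists l, lipschitz_with l f.

Definition generator {a} p (g : nat -> nat -> nat -> R)
    (f : state a -> R) (eta : state a) : R :=
  rsum [set w : site d * site d * nat | (0 < w.2)%N]
    (fun w => let: (x, y, k) := w in
      p x y * g k (val eta x) (val eta y) * (f (sjump k x y eta) - f eta)).

(* In general generator p g f is not in Lip when f is, so S t has to act beyond
   Lip for the commutation sg_comm to make sense. S t is therefore an operator
   on all functions, and nothing else is required of it outside of Lip. *)
Record markov_semigroup {a} p (g : nat -> nat -> nat -> R)
    (S : R -> (state a -> R) -> (state a -> R)) : Prop := MarkovSemigroup {
  sg_Lip : forall (t : R) f, 0 <= t -> Lip f -> Lip (S t f) ;
  sg_linear : forall (t b : R) f h eta, 0 <= t -> Lip f -> Lip h ->
    S t (fun zeta => b * f zeta + h zeta) eta = b * S t f eta + S t h eta ;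
  sg_ge0 : forall (t : R) f eta, 0 <= t -> Lip f -> (forall zeta, 0 <= f zeta) ->
    0 <= S t f eta ;
  sg_one : forall (t : R) eta, 0 <= t -> S t (fun _ => 1) eta = 1 ;
  sg_add : forall (t1 t2 : R) f eta, 0 <= t1 -> 0 <= t2 -> Lip f ->
    S (t1 + t2) f eta = S t1 (S t2 f) eta ;
  sg_zero : forall f eta, Lip f -> S 0 f eta = f eta ;
  sg_integral : forall (t : R) f eta, 0 <= t -> Lip f ->
    S t f eta = f eta +
      \int[@lebesgue_measure R]_(s in `[0, t]) generator p g (S s f) eta ;
  sg_bound : exists2 c : R, 0 < c & forall (t : R) f l eta, 0 <= t ->
    lipschitz_with l f ->
    (`|S t f eta - f eta|%:E <=
       cnorm a (val eta) * (l * (expR (c * t) - 1))%:E)%E ;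
  sg_continuous : forall f eta, Lip f ->
    {within `[0, +oo[, continuous (fun t : R => S t f eta)} ;
  sg_generator_continuous : forall f eta, Lip f ->
    {within `[0, +oo[, continuous (fun t : R => generator p g (S t f) eta)} ;
  sg_derivative : forall f eta, Lip f ->
    (S t f eta - f eta) / t @[t --> 0^'+] --> generator p g f eta ;
  sg_comm : forall (t : R) f eta, 0 <= t -> Lip f ->
    generator p g (S t f) eta = S t (generator p g f) eta }.

End semigroup.

(* Product sigma-algebra on config d, each factor nat being discrete. *)
Definition cylinder1 (d : nat) : set (set (config d)) :=
  [set A | exists x (B : set nat), A = [set eta | B (eta x)]].

Definition mconfig (d : nat) := g_sigma_algebraType (@cylinder1 d).

Section measures.
Context {R : realType} {d : nat}.
Implicit Types nu : probability (mconfig d) R.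

Definition product_probability nu : Prop :=
  forall (J : seq (site d)) (B : site d -> set nat), uniq J ->
    (nu [set eta | forall x, x \in J -> B x (eta x)] =
     \prod_(x <- J) nu [set eta | B x (eta x)])%E.

Definition translation_invariant_probability nu : Prop :=
  forall (z : site d) (A : set (mconfig d)), measurable A ->
    nu [set eta | A (fun x => eta (x + z))] = nu A.

Definition marginal nu (n : nat) : R := fine (nu [set eta | eta 0 = n]).

Definition finite_first_moment (mu : nat -> R) : Prop :=
  (\esum_(n in [set: nat]) (n%:R * mu n)%:E < +oo)%E.

(* Extension by 0 outside of the state space. *)
Definition extend0 {a : site d -> R} (f : state a -> R) (eta : mconfig d) : R :=
  oapp f 0 (insub eta).

Definition invariant_probability {a : site d -> R}
    (S : R -> (state a -> R) -> (state a -> R)) nu : Prop :=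
  nu (finite_norm a) = 1%E /\
  forall f t, Lip f -> (exists K, forall eta, `|f eta| <= K) -> 0 <= t ->
    (\int[nu]_eta (extend0 (S t f) eta)%:E = \int[nu]_eta (extend0 f eta)%:E)%E.

End measures.

Section conditions.
Context {R : realType}.
Implicit Types (g : nat -> nat -> nat -> R) (mu psi : nat -> R).

Definition Afun g mu (alpha beta : nat) : R :=
  if mu alpha * mu beta != 0 then
    \sum_(0 <= k < beta.+1) g k (alpha + k)%N (beta - k)%N *
       ((mu (alpha + k)%N * mu (beta - k)%N) / (mu alpha * mu beta))
    - \sum_(0 <= k < alpha.+1) g k alpha beta
  else 0.

Definition condition1 g mu : Prop := forall alpha beta : nat,
  mu alpha * mu beta = 0 ->
  \sum_(0 <= k < beta.+1)
    g k (alpha + k)%N (beta - k)%N * mu (alpha + k)%N * mu (beta - k)%N = 0.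

Definition condition2 g mu : Prop := forall alpha beta : nat,
  Afun g mu alpha beta = - Afun g mu beta alpha.

Definition condition3 g mu : Prop := exists psi, forall alpha beta : nat,
  mu alpha * mu beta != 0 -> Afun g mu alpha beta = psi beta - psi alpha.

End conditions.

(* Main.v *)
Require Import Defs.
From mathcomp Require Import all_boot all_order all_algebra.
From mathcomp Require Import all_classical all_reals all_analysis.
From mathcomp Require Import measurable_realfun ring lra.

Set Implicit Arguments.
Unset Strict Implicit.
Unset Printing Implicit Defensive.
Import Order.TTheory GRing.Theory Num.Theory.
Import numFieldNormedType.Exports.

Local Open Scope classical_set_scope.
Local Open Scope ring_scope.

(** A product measure nu is invariant as soon as, and only if, the mean under nu
    of the generator applied to any bounded Lipschitz function f vanishes. The
    difference quotients of t |-> S(t) f at 0 are dominated by a multiple of the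
    norm of the configuration, which is integrable since the marginal mu has a
    first moment. Hence the mean of S(t) f is continuous in t and has the mean of
    the generator at S(t) f as right derivative ([mean_difference_quotient],
    [zero_right_derivative], [invariant_generator]).

    Under nu the values at two sites x and y are independent of each other and of
    the other coordinates. Changing variables in the terms of the generator that
    are evaluated after a jump, its mean becomes the sum over pairs of sites of
    p(x, y) times the flux
      flux(x, y) = sum over k, l of D(k, l) E[f | k particles at x and l at y],
    where D(k, l) is the rate at which the jumps from x to y bring the values at
    (x, y) to (k, l), minus the rate at which they change them from (k, l)
    ([integral_inflow], [integral_outflow], [integral_generator]). If
    mu(k) mu(l) is not 0 then D(k, l) = mu(k) mu(l) A(k, l), and condition (1)
    says that D vanishes at the other pairs. So, given (1), condition (2) says
    that D is antisymmetric, and (3) that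
    D(k, l) = mu(k) mu(l) (psi(l) - psi(k)).

    Sufficiency. If D is antisymmetric, so is the flux in (x, y), and its sum
    against a symmetric p is 0. If D comes from psi, then
    flux(x, y) = u(y) - u(x) for a function u on the sites ([flux_increment]).
    The Lipschitz property bounds the flux by a multiple of a(x) + a(y), which
    makes u summable up to an additive constant, and then the sum of
    p(x, y) (u(y) - u(x)) is 0 because p is stochastic in both variables
    ([kernel_increments_rsum0]).

    Necessity. Take for f the indicator of having k particles at x and l at y.
    Only the jumps that involve x or y contribute; with d(k) the sum of D(k, l)
    over l, the outcome is ([net_flow_relation])
      p(x, y) D(k, l) + p(y, x) D(l, k)
        = (p(x, y) - p(y, x)) (mu(l) d(k) - mu(k) d(l)).
    Adding the same relation with k and l exchanged shows that D is
    antisymmetric. As D is nonnegative wherever mu(k) mu(l) = 0, this yields (1)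
    as well as (2). If p(x, y) and p(y, x) differ for some x and y, the relation
    gives (3) with psi = - d / mu. *)

(** * Sums over countable families *)

Section esum_countable.
Local Open Scope ereal_scope.
Context {R : realType}.

Lemma esumZl (I : choiceType) (D : set I) (c : R) (a : I -> \bar R) :
  (0 <= c)%R -> (forall i, 0 <= a i) ->
  \esum_(i in D) (c%:E * a i) = c%:E * \esum_(i in D) a i.
Proof.
move=> c0 a0; rewrite /esum -ereal_supZl//; last first.
  by apply/set0P; exists 0, set0; [exact: fsets_set0|rewrite fsbig_set0].
congr ereal_sup; rewrite image_comp; apply: eq_imagel => X _ /=.
by rewrite ge0_mule_fsumr.
Qed.

Lemma esumZr (I : choiceType) (D : set I) (c : R) (a : I -> \bar R) :
  (0 <= c)%R -> (forall i, 0 <= a i) ->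
  \esum_(i in D) (a i * c%:E) = (\esum_(i in D) a i) * c%:E.
Proof.
move=> c0 a0; rewrite muleC -esumZl//.
by apply: eq_esum => i _; rewrite muleC.
Qed.

(** Enumerating a countable index type turns unordered sums into series, to
    which monotone convergence applies. *)
Lemma esum_countType (I : countType) (D : set I) (a : I -> \bar R) :
  (forall i, 0 <= a i) ->
  \esum_(i in D) a i =
  \sum_(0 <= n <oo) oapp (fun i => if i \in D then a i else 0) 0 (pickle_inv n).
Proof.
move=> a0; rewrite esum_mkcond; set b := (fun i => if _ then _ else _).
have b0 i : 0 <= b i by rewrite /b; case: ifP.
rewrite nneseries_esumT => [|n]; last by case: pickle_inv => //=.
rewrite [RHS](esumID [set pickle i | i in [set: I]])//=; last first.
  by move=> n _; case: pickle_inv => //=.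
rewrite [X in _ = _ + X]esum1 ?adde0; last first.
  move=> n [_ /= nI]; case E : (pickle_inv n) => [i|]//=.
  by exfalso; apply: nI; exists i => //; have := @pickle_invK I n; rewrite E.
have bij : set_bij [set: I] [set pickle i | i in [set: I]] (@pickle I).
  by split=> // i j _ _ /(pcan_inj pickleK).
rewrite setTI (reindex_esum _ _ _ _ bij).
by apply: eq_esum => i _; rewrite pickleK_inv.
Qed.

Context {d : measure_display} {T : measurableType d}
  (m : {measure set T -> \bar R}).

Lemma measurable_esum (I : countType) (D : set I) (h : I -> T -> \bar R) :
  (forall i x, 0 <= h i x) -> (forall i, measurable_fun setT (h i)) ->
  measurable_fun setT (fun x => \esum_(i in D) h i x).
Proof.
move=> h0 mh; under eq_fun do rewrite esum_countType//.
apply: (@ge0_emeasurable_sum _ _ _ _ _ xpredT).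
  by move=> k x _ _; case: pickle_inv => //= i; case: ifP.
by move=> k _ /=; case: (@pickle_inv I k) => [i|] /=; [case: (i \in D)|];
  [exact: mh|exact: measurable_cst..].
Qed.

Lemma integral_esum (I : countType) (D : set I) (h : I -> T -> \bar R) :
  (forall i x, 0 <= h i x) -> (forall i, measurable_fun setT (h i)) ->
  \int[m]_x (\esum_(i in D) h i x) = \esum_(i in D) \int[m]_x h i x.
Proof.
move=> h0 mh; under eq_integral do rewrite esum_countType//.
rewrite integral_nneseries//; last 2 first.
- by move=> n /=; case: (@pickle_inv I n) => [i|] /=; [case: (i \in D)|];
    [exact: mh|exact: measurable_cst..].
- by move=> n x _; case: pickle_inv => //= i; case: ifP.
rewrite esum_countType//; last by move=> i; exact: integral_ge0.
apply: eq_eseriesr => n _; case: pickle_inv => /= [i|]; last exact: integral0.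
by case: ifP => // _; exact: integral0.
Qed.

End esum_countable.

Section rsum.
Context {R : realType}.
Implicit Types (I : choiceType).

Definition rsummable I (D : set I) (u : I -> R) := summable D (EFin \o u).

Lemma eq_rsum I (D : set I) (u v : I -> R) :
  (forall i, D i -> u i = v i) -> rsum D u = rsum D v.
Proof.
move=> uv; rewrite /rsum; congr (fine (_ - _)); apply: eq_esum => i /uv Di.
- by rewrite !funeposE /= Di.
- by rewrite !funenegE /= Di.
Qed.

Lemma le_rsummable I (D : set I) (u v : I -> R) :
  (forall i, D i -> `|u i| <= v i) -> (\esum_(i in D) (v i)%:E < +oo)%E ->
  rsummable D u.
Proof.
by move=> uv; apply: le_lt_trans; apply: le_esum => i Di; rewrite lee_fin uv.
Qed.

Lemma ge0_rsummable I (D : set I) (u : I -> R) : (forall i, 0 <= u i) ->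
  (\esum_(i in D) (u i)%:E < +oo)%E -> rsummable D u.
Proof. by move=> u0; apply: le_rsummable => i _; rewrite ger0_norm. Qed.

Lemma rsummable_pos I (D : set I) (u : I -> R) : rsummable D u ->
  (\esum_(i in D) (Num.max (u i) 0)%:E < +oo)%E.
Proof.
apply: le_lt_trans; apply: le_esum => i _; rewrite lee_fin ge_max normr_ge0.
by rewrite ler_norm.
Qed.

Lemma rsummableD I (D : set I) (u v : I -> R) :
  rsummable D u -> rsummable D v -> rsummable D (fun i => u i + v i).
Proof. exact: summableD. Qed.

Lemma rsummableZ I (D : set I) (c : R) (u : I -> R) :
  rsummable D u -> rsummable D (fun i => c * u i).
Proof.
rewrite /rsummable /summable => su.
rewrite [X in (X < _)%E](_ : _ =
  (`|c|%:E * \esum_(x in D) `|(EFin \o u) x|)%E); last first.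
  by rewrite -esumZl//; apply: eq_esum => i _; rewrite /= normrM EFinM.
by rewrite lte_mul_pinfty// lee_fin.
Qed.

Lemma rsummableN I (D : set I) (u : I -> R) :
  rsummable D u -> rsummable D (fun i => - u i).
Proof.
by move=> /(rsummableZ (-1)); rewrite /rsummable; under eq_fun do rewrite mulN1r.
Qed.

(** Any splitting into summable nonnegative parts computes the sum, not only
    the one into positive and negative parts; the rules of calculation below
    all come down to this. *)
Lemma rsum_diff I (D : set I) (u v : I -> R) :
  (forall i, 0 <= u i) -> (forall i, 0 <= v i) ->
  (\esum_(i in D) (u i)%:E < +oo)%E -> (\esum_(i in D) (v i)%:E < +oo)%E ->
  rsum D (fun i => u i - v i) =
  fine (\esum_(i in D) (u i)%:E) - fine (\esum_(i in D) (v i)%:E).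
Proof.
move=> u0 v0 su sv; rewrite /rsum.
have := @esumB R I D (EFin \o u) (EFin \o v) (ge0_rsummable u0 su)
  (ge0_rsummable v0 sv) (fun i _ => u0 i) (fun i _ => v0 i).
rewrite (_ : (_ \- _)%E = EFin \o (fun i => u i - v i))// => ->.
by rewrite fineB// ge0_fin_numE// esum_ge0// => i _; rewrite lee_fin.
Qed.

Lemma rsum_ge0 I (D : set I) (u : I -> R) : (forall i, 0 <= u i) ->
  (\esum_(i in D) (u i)%:E < +oo)%E ->
  rsum D u = fine (\esum_(i in D) (u i)%:E).
Proof.
move=> u0 su; have z0 : (\esum_(i in D) (0 : R)%:E = 0)%E by rewrite esum1.
rewrite [LHS](eq_rsum (fun i _ => esym (subr0 (u i)))).
by rewrite (@rsum_diff _ _ u (fun=> 0))// ?z0 ?ltry// subr0.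
Qed.

Lemma rsum0 I (D : set I) : rsum D (fun=> 0) = 0 :> R.
Proof. by rewrite rsum_ge0// esum1// ltry. Qed.

Lemma posneg (x : R) : x = Num.max x 0 - Num.max (- x) 0.
Proof.
rewrite !maxElt oppr_lt0.
by case: (ltgtP x 0) => [_|_|->]; rewrite ?opprK ?oppr0 ?add0r ?addr0.
Qed.

Lemma rsumE I (D : set I) (u : I -> R) : rsummable D u ->
  rsum D u = fine (\esum_(i in D) (Num.max (u i) 0)%:E) -
             fine (\esum_(i in D) (Num.max (- u i) 0)%:E).
Proof.
move=> su; rewrite [LHS](eq_rsum (fun i _ => posneg (u i))) rsum_diff//.
- by move=> i; rewrite le_max lexx orbT.
- by move=> i; rewrite le_max lexx orbT.
- exact: rsummable_pos.
- exact/rsummable_pos/rsummableN.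
Qed.

Lemma rsumD I (D : set I) (u v : I -> R) : rsummable D u -> rsummable D v ->
  rsum D (fun i => u i + v i) = rsum D u + rsum D v.
Proof.
move=> su sv; rewrite (rsumE su) (rsumE sv).
have p0 (x : R) : 0 <= Num.max x 0 by rewrite le_max lexx orbT.
have fn w : rsummable D w ->
    (\esum_(i in D) (Num.max (w i) 0)%:E)%E \is a fin_num.
  move=> sw; rewrite ge0_fin_numE ?rsummable_pos// esum_ge0// => i _.
  by rewrite lee_fin.
pose pu i := Num.max (u i) 0; pose nu i := Num.max (- u i) 0.
pose pv i := Num.max (v i) 0; pose nv i := Num.max (- v i) 0.
have -> : rsum D (fun i => u i + v i) =
          rsum D (fun i => (pu i + pv i) - (nu i + nv i)).
  apply: eq_rsum => i _; rewrite {1}(posneg (u i)) {1}(posneg (v i)).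
  by rewrite addrACA opprD.
have eD (x y : I -> R) : (forall i, 0 <= x i) -> (forall i, 0 <= y i) ->
    (\esum_(i in D) (x i + y i)%:E =
     \esum_(i in D) (x i)%:E + \esum_(i in D) (y i)%:E)%E.
  by move=> x0 y0; rewrite -esumD// => i _; rewrite lee_fin.
rewrite rsum_diff.
- rewrite eD ?eD//; try by move=> i; exact: p0.
  rewrite !fineD ?fn//; [|exact: rsummableN..].
  by rewrite opprD addrACA.
- by move=> i; rewrite addr_ge0// p0.
- by move=> i; rewrite addr_ge0// p0.
- rewrite eD; [|by move=> i; exact: p0..].
  by rewrite lte_add_pinfty// rsummable_pos.
- rewrite eD; [|by move=> i; exact: p0..].
  by rewrite lte_add_pinfty// rsummable_pos//; exact: rsummableN.
Qed.

Lemma fin_num_rsummable I (D : set I) (u : I -> R) : rsummable D u ->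
  (\esum_(i in D) (Num.max (u i) 0)%:E)%E \is a fin_num.
Proof.
move=> su; rewrite ge0_fin_numE ?rsummable_pos// esum_ge0// => i _.
by rewrite lee_fin le_max lexx orbT.
Qed.

Lemma rsumN I (D : set I) (u : I -> R) : rsummable D u ->
  rsum D (fun i => - u i) = - rsum D u.
Proof.
move=> su; rewrite (rsumE su) (rsumE (rsummableN su)) opprB.
by congr (_ - fine _); apply: eq_esum => i _; rewrite opprK.
Qed.

Lemma rsumZ I (D : set I) (c : R) (u : I -> R) : rsummable D u ->
  rsum D (fun i => c * u i) = c * rsum D u.
Proof.
wlog c0 : c u / 0 <= c.
  move=> H su; have [/H->//|/ltW c0] := leP 0 c.
  rewrite -[in RHS](opprK c) mulNr -mulrN -rsumN// -H ?oppr_ge0//.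
    by apply: eq_rsum => i _; rewrite mulrNN.
  exact: rsummableN.
move=> su; rewrite (rsumE su) (rsumE (rsummableZ c su)) mulrBr.
have p0 i : 0 <= Num.max (u i) 0 by rewrite le_max lexx orbT.
have n0 i : 0 <= Num.max (- u i) 0 by rewrite le_max lexx orbT.
congr (_ - _).
- under eq_esum do rewrite -{1}(mulr0 c) -maxr_pMr// EFinM.
  rewrite esumZl// ?fineM// ge0_fin_numE ?rsummable_pos// esum_ge0// => i _.
  by rewrite lee_fin.
- under eq_esum do rewrite -mulrN -{1}(mulr0 c) -maxr_pMr// EFinM.
  rewrite esumZl// ?fineM// ge0_fin_numE; last first.
    by rewrite esum_ge0// => i _; rewrite lee_fin.
  by rewrite rsummable_pos//; exact: rsummableN.
Qed.

Lemma rsumB I (D : set I) (u v : I -> R) : rsummable D u -> rsummable D v ->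
  rsum D (fun i => u i - v i) = rsum D u - rsum D v.
Proof. by move=> su sv; rewrite rsumD ?rsumN//; exact: rsummableN. Qed.

Lemma ler_norm_rsum I (D : set I) (u v : I -> R) :
  (forall i, D i -> `|u i| <= v i) -> (\esum_(i in D) (v i)%:E < +oo)%E ->
  `|rsum D u| <= fine (\esum_(i in D) (v i)%:E).
Proof.
move=> uv sv; have su := le_rsummable uv sv; rewrite (rsumE su).
have v0 : (\esum_(i in D) (v i)%:E)%E \is a fin_num.
  rewrite ge0_fin_numE// esum_ge0// => i Di.
  by rewrite lee_fin (le_trans (normr_ge0 _) (uv i Di)).
have H w : (forall i, D i -> w i <= v i) -> rsummable D w ->
    0 <= fine (\esum_(i in D) (Num.max (w i) 0)%:E) <= fine (\esum_(i in D) (v i)%:E).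
  move=> wv sw; rewrite fine_ge0/=; last first.
    by rewrite esum_ge0// => i _; rewrite lee_fin le_max lexx orbT.
  rewrite fine_le ?fin_num_rsummable//; apply: le_esum => i Di.
  by rewrite lee_fin ge_max wv// (le_trans (normr_ge0 _) (uv i Di)).
have /andP[P0 PV] := H u (fun i Di => le_trans (ler_norm _) (uv i Di)) su.
have /andP[N0 NV] : 0 <= fine (\esum_(i in D) (Num.max (- u i) 0)%:E) <=
    fine (\esum_(i in D) (v i)%:E).
  apply: (H (fun i => - u i)); last exact: rsummableN.
  by move=> i Di; rewrite (le_trans (ler_norm _))// normrN uv.
by rewrite ler_norml lerBrDl lerBlDl addrC -lerBrDl; apply/andP; split; lra.
Qed.

Lemma esum_pair (I J : choiceType) (v : I * J -> \bar R) :
  (forall z, 0 <= v z)%E ->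
  (\esum_(z in [set: I * J]) v z =
   \esum_(i in [set: I]) \esum_(j in [set: J]) v (i, j))%E.
Proof.
move=> v0; rewrite esum_esum//; transitivity (\esum_(z in [set: I * J]) v (z.1, z.2)).
  by apply: eq_esum => -[].
by congr (esum _ _); apply/seteqP; split.
Qed.

(** Fubini for absolutely summable families, by splitting both the double sum
    and its inner sums into positive and negative parts. *)
Lemma rsum_pair (I J : choiceType) (u : I * J -> R) : rsummable setT u ->
  [/\ forall i, rsummable setT (fun j => u (i, j)),
      rsummable setT (fun i => rsum setT (fun j => u (i, j))) &
      rsum setT u = rsum setT (fun i => rsum setT (fun j => u (i, j)))].
Proof.
move=> su.
have p0 (x : R) : 0 <= Num.max x 0 by rewrite le_max lexx orbT.
have p0e (x : R) : (0 <= (Num.max x 0)%:E)%E by rewrite lee_fin.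
have fin (v : I * J -> R) : (forall z, 0 <= v z) ->
    (\esum_(z in [set: I * J]) (v z)%:E < +oo)%E ->
    forall i, (\esum_(j in [set: J]) (v (i, j))%:E < +oo)%E.
  move=> v0 + i; apply: le_lt_trans.
  rewrite (esum_pair (v := fun z => (v z)%:E))//.
  rewrite [leRHS](esumID [set i])/=; last first.
    by move=> k _; rewrite esum_ge0// => j _; rewrite lee_fin.
  rewrite setTI esum_set1; last by rewrite esum_ge0// => j _; rewrite lee_fin.
  by rewrite leeDl// esum_ge0// => k _; rewrite esum_ge0// => j _; rewrite lee_fin.
have si i : rsummable setT (fun j => u (i, j)).
  rewrite /rsummable /summable /=.
  exact: (fin (fun z => `|u z|)).
have sn : rsummable setT (fun i => fine (\esum_(j in [set: J]) `|u (i, j)|%:E)).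
  apply: ge0_rsummable => [i|].
    by rewrite fine_ge0// esum_ge0// => j _; rewrite lee_fin.
  move: su; rewrite /rsummable /summable /=.
  rewrite (esum_pair (v := fun z => `|u z|%:E))//; apply: le_lt_trans.
  apply: le_esum => i _; rewrite fineK// ge0_fin_numE ?esum_ge0//.
  exact: si.
split => //.
  apply: (@le_rsummable _ _ _
      (fun i => fine (\esum_(j in [set: J]) `|u (i, j)|%:E))).
    by move=> i _; apply: ler_norm_rsum => //; exact: si.
  have := sn; rewrite /rsummable /summable.
  by apply: le_lt_trans; apply: le_esum => i _; rewrite /= lee_fin ler_norm.
rewrite (rsumE su) (eq_rsum (fun i _ => rsumE (si i))) rsum_diff.
- have E (v : I * J -> R) : (forall z, 0 <= v z) ->
      (\esum_(z in [set: I * J]) (v z)%:E < +oo)%E ->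
      (\esum_(z in [set: I * J]) (v z)%:E =
       \esum_(i in [set: I]) (fine (\esum_(j in [set: J]) (v (i, j))%:E))%:E)%E.
    move=> v0 sv; rewrite (esum_pair (v := fun z => (v z)%:E))//.
    apply: eq_esum => i _; rewrite fineK// ge0_fin_numE.
      exact: fin.
    by rewrite esum_ge0// => j _; rewrite lee_fin.
  rewrite (E (fun z => Num.max (u z) 0))//; last exact: rsummable_pos.
  rewrite (E (fun z => Num.max (- u z) 0))//.
  exact/rsummable_pos/rsummableN.
- by move=> i; rewrite fine_ge0// esum_ge0// => j _; rewrite lee_fin.
- by move=> i; rewrite fine_ge0// esum_ge0// => j _; rewrite lee_fin.
- have := rsummable_pos su.
  rewrite (esum_pair (v := fun z => (Num.max (u z) 0)%:E)) => [|z]; last exact: p0e.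
  apply: le_lt_trans; apply: le_esum => i _; rewrite fineK//.
  exact: fin_num_rsummable.
- have := rsummable_pos (rsummableN su).
  rewrite (esum_pair (v := fun z => (Num.max (- u z) 0)%:E)) => [|z]; last exact: p0e.
  apply: le_lt_trans; apply: le_esum => i _; rewrite fineK//.
  exact: (fin_num_rsummable (rsummableN (si i))).
Qed.

Lemma reindex_rsum (I J : choiceType) (D : set I) (E : set J) (e : I -> J)
    (u : J -> R) : set_bij D E e -> rsum E u = rsum D (u \o e).
Proof.
by move=> bij; rewrite /rsum; congr (fine (_ - _));
  rewrite (reindex_esum D E e _ bij); apply: eq_esum => i _;
  by rewrite ?funeposE ?funenegE.
Qed.

Lemma rsum_single I (i0 : I) (c : R) :
  rsummable setT (fun i => (i == i0)%:R * c) /\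
  rsum setT (fun i => (i == i0)%:R * c) = c.
Proof.
have s1 : (\esum_(i in [set: I]) ((i == i0)%:R : R)%:E = 1)%E.
  rewrite (esumID [set i0])//= setTI esum_set1 ?eqxx ?lee_fin//.
  rewrite esum1 ?adde0// => i [_ /= /eqP/negbTE ->]//.
have ss : rsummable setT (fun i : I => (i == i0)%:R : R).
  by apply: ge0_rsummable => //; rewrite s1 ltry.
have -> : (fun i : I => (i == i0)%:R * c) = (fun i => c * (i == i0)%:R).
  by apply/funext => i; rewrite mulrC.
split; first exact: rsummableZ.
by rewrite rsumZ// rsum_ge0// ?s1 ?ltry// mulr1.
Qed.

End rsum.

Lemma esum_le_nat {R : realType} (n : nat) (u : nat -> R) :
  (forall k, 0 <= u k) ->
  (\esum_(k in [set k | (k <= n)%N]) (u k)%:E = (\sum_(0 <= k < n.+1) u k)%:E)%E.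
Proof.
move=> u0; rewrite (_ : [set k | _] = `I_n.+1)//.
have fin : finite_set `I_n.+1 by exact: finite_II.
transitivity (\sum_(i \in `I_n.+1) (u i)%:E)%E.
  rewrite -esum_fset// ?set_mem_set// => i _; by rewrite lee_fin.
by rewrite -fsbig_ord big_mkord sumEFin.
Qed.

Lemma rsum_restrict {R : realType} (I : choiceType) (D : set I) (u : I -> R) :
  (forall i, ~ D i -> u i = 0) -> rsum D u = rsum setT u.
Proof.
move=> u0; rewrite /rsum; congr (fine (_ - _)); rewrite esum_mkcond;
  apply: eq_esum => i _; case: ifPn => // /negP; rewrite inE => /u0.
- by rewrite funeposE /= => ->; rewrite maxxx.
- by rewrite funenegE /= => ->; rewrite ?oppr0 maxxx.
Qed.

Lemma rsum_swap_antisym {R : realType} (I : choiceType) (u : I * I -> R) :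
  rsummable setT u -> (forall x y, u (y, x) = - u (x, y)) -> rsum setT u = 0.
Proof.
move=> su anti.
have swap : set_bij [set: I * I] [set: I * I] (fun w => (w.2, w.1)).
  split=> //; first by move=> [x y] [z w] _ _ [-> ->].
  by move=> [x y] _; exists (y, x).
have : rsum setT u = - rsum setT u.
  rewrite -rsumN// {1}(reindex_rsum _ swap); apply: eq_rsum => -[x y] _ /=.
  exact: anti.
by move=> ?; lra.
Qed.

Section integral_rsum.
Context {R : realType} {d : measure_display} {T : measurableType d}
  (m : {measure set T -> \bar R}).

Lemma integral_posneg (u : T -> R) : measurable_fun setT u ->
  (\int[m]_x `|u x|%:E < +oo)%E ->
  [/\ (\int[m]_x (Num.max (u x) 0)%:E < +oo)%E,
      (\int[m]_x (Num.max (- u x) 0)%:E < +oo)%E &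
      \int[m]_x (u x)%:E = (fine (\int[m]_x (Num.max (u x) 0)%:E) -
                            fine (\int[m]_x (Num.max (- u x) 0)%:E))%:E]%E.
Proof.
move=> mu iu.
have ip : (\int[m]_x (Num.max (u x) 0)%:E < +oo)%E.
  apply: le_lt_trans iu; apply: ge0_le_integral => //.
  - by move=> x _; rewrite lee_fin le_max lexx orbT.
  - apply/measurable_EFinP; apply: measurable_maxr => //; exact: measurable_cst.
  - by apply/measurable_EFinP; exact: measurableT_comp.
  - by move=> x _; rewrite lee_fin ge_max normr_ge0 ler_norm.
have in_ : (\int[m]_x (Num.max (- u x) 0)%:E < +oo)%E.
  apply: le_lt_trans iu; apply: ge0_le_integral => //.
  - by move=> x _; rewrite lee_fin le_max lexx orbT.
  - apply/measurable_EFinP; apply: measurable_maxr => //.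
    exact: measurableT_comp.
  - by apply/measurable_EFinP; exact: measurableT_comp.
  - by move=> x _; rewrite lee_fin ge_max normr_ge0 -normrN ler_norm.
split=> //; rewrite integralE.
have -> : (\int[m]_x (EFin \o u)^\+ x = \int[m]_x (Num.max (u x) 0)%:E)%E.
  by apply: eq_integral => x _; rewrite funeposE /= EFin_max.
have -> : (\int[m]_x (EFin \o u)^\- x = \int[m]_x (Num.max (- u x) 0)%:E)%E.
  by apply: eq_integral => x _; rewrite funenegE EFin_max.
rewrite EFinB !fineK// ge0_fin_numE// integral_ge0// => x _;
  by rewrite lee_fin le_max lexx orbT.
Qed.

(** Positive and negative parts are exchanged with the integral separately, by
    monotone convergence. Their sums are almost surely finite, so the value
    given to sums that do not converge only matters on a null set. *)
Lemma integral_rsum (I : countType) (D : set I) (u : I -> T -> R) :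
  (forall i, measurable_fun setT (u i)) ->
  (\esum_(i in D) \int[m]_x `|u i x|%:E < +oo)%E ->
  [/\ measurable_fun setT (fun x => rsum D (u ^~ x)),
      rsummable D (fun i => fine (\int[m]_x (u i x)%:E)) &
      \int[m]_x (rsum D (u ^~ x))%:E =
      (rsum D (fun i => fine (\int[m]_x (u i x)%:E)))%:E]%E.
Proof.
move=> mu iu.
pose P x := (\esum_(i in D) (Num.max (u i x) 0)%:E)%E.
pose N x := (\esum_(i in D) (Num.max (- u i x) 0)%:E)%E.
have p0 (x : R) : 0 <= Num.max x 0 by rewrite le_max lexx orbT.
have rsumPN x : rsum D (u ^~ x) = fine (P x - N x).
  rewrite /rsum; congr (fine (_ - _)); apply: eq_esum => i _.
    by rewrite funeposE /= EFin_max.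
  by rewrite funenegE EFin_max.
have mp i : measurable_fun setT (fun x => (Num.max (u i x) 0)%:E).
  by apply/measurable_EFinP; apply: measurable_maxr => //; exact: measurable_cst.
have mn i : measurable_fun setT (fun x => (Num.max (- u i x) 0)%:E).
  by apply/measurable_EFinP; apply: measurable_maxr => //; exact: measurableT_comp.
have mP : measurable_fun setT P.
  by apply: measurable_esum => // i x; rewrite lee_fin.
have mN : measurable_fun setT N.
  by apply: measurable_esum => // i x; rewrite lee_fin.
have P0 x : (0 <= P x)%E by apply: esum_ge0 => i _; rewrite lee_fin.
have N0 x : (0 <= N x)%E by apply: esum_ge0 => i _; rewrite lee_fin.
have fu i : D i -> (\int[m]_x `|u i x|%:E < +oo)%E.
  move=> Di; apply: le_lt_trans iu; rewrite (esumID [set i])/=; last first.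
    by move=> j _; apply: integral_ge0 => x _; rewrite lee_fin.
  rewrite (_ : D `&` [set i] = [set i]); last by apply/seteqP; split=> [j []//|j ->].
  rewrite esum_set1; last by apply: integral_ge0 => x _; rewrite lee_fin.
  by apply: leeDl; apply: esum_ge0 => j _; apply: integral_ge0 => x _; rewrite lee_fin.

have iPE : (\int[m]_x P x = \esum_(i in D) \int[m]_x (Num.max (u i x) 0)%:E)%E.
  by rewrite integral_esum// => i x; rewrite lee_fin.
have iNE : (\int[m]_x N x = \esum_(i in D) \int[m]_x (Num.max (- u i x) 0)%:E)%E.
  by rewrite integral_esum// => i x; rewrite lee_fin.
have iPoo : (\int[m]_x P x < +oo)%E.
  rewrite iPE; apply: le_lt_trans iu; apply: le_esum => i _.
  apply: ge0_le_integral => //.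
  - by move=> x _; rewrite lee_fin.
  - by apply/measurable_EFinP; exact: measurableT_comp.
  - by move=> x _; rewrite lee_fin ge_max normr_ge0 ler_norm.
have iNoo : (\int[m]_x N x < +oo)%E.
  rewrite iNE; apply: le_lt_trans iu; apply: le_esum => i _.
  apply: ge0_le_integral => //.
  - by move=> x _; rewrite lee_fin.
  - by apply/measurable_EFinP; exact: measurableT_comp.
  - by move=> x _; rewrite lee_fin ge_max normr_ge0 -normrN ler_norm.
have iP : m.-integrable setT P.
  by apply/integrableP; split=> //; under eq_integral do rewrite gee0_abs//.
have iN : m.-integrable setT N.
  by apply/integrableP; split=> //; under eq_integral do rewrite gee0_abs//.
have iPN := integrableB measurableT iP iN.
have mr : measurable_fun setT (fun x => (rsum D (u ^~ x))%:E).
  apply/measurable_EFinP; under eq_fun do rewrite rsumPN.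
  by apply: measurableT_comp => //; exact: emeasurable_funB.
have ae : ae_eq m setT (P \- N)%E (fun x => (rsum D (u ^~ x))%:E).
  have := integrable_ae measurableT iPN.
  by apply: filterS => x /(_ Logic.I) PN _; rewrite rsumPN fineK.
pose v i := fine (\int[m]_x (Num.max (u i x) 0)%:E)%E.
pose w i := fine (\int[m]_x (Num.max (- u i x) 0)%:E)%E.
have iv i : D i -> (v i)%:E = (\int[m]_x (Num.max (u i x) 0)%:E)%E.
  move=> /fu /(integral_posneg (mu i)) [? _ _].
  by rewrite fineK// ge0_fin_numE// integral_ge0// => x _; rewrite lee_fin.
have iw i : D i -> (w i)%:E = (\int[m]_x (Num.max (- u i x) 0)%:E)%E.
  move=> /fu /(integral_posneg (mu i)) [_ ? _].
  by rewrite fineK// ge0_fin_numE// integral_ge0// => x _; rewrite lee_fin.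
have v0 i : 0 <= v i by rewrite fine_ge0// integral_ge0// => x _; rewrite lee_fin.
have w0 i : 0 <= w i by rewrite fine_ge0// integral_ge0// => x _; rewrite lee_fin.
have sv : (\esum_(i in D) (v i)%:E = \int[m]_x P x)%E.
  by rewrite iPE; exact: eq_esum.
have sw : (\esum_(i in D) (w i)%:E = \int[m]_x N x)%E.
  by rewrite iNE; exact: eq_esum.
have uvw i : D i -> fine (\int[m]_x (u i x)%:E) = v i - w i.
  by move=> /fu /(integral_posneg (mu i)) [_ _ ->].
split.
- exact/measurable_EFinP.
- apply: (@le_rsummable _ _ _ _ (fun i => v i + w i)).
    by move=> i Di; rewrite uvw// (le_trans (ler_normB _ _))// !ger0_norm.
  under eq_esum do rewrite EFinD.
  rewrite esumD; [|by move=> i _; rewrite lee_fin..].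
  by rewrite sv sw lte_add_pinfty.
- have mPN : measurable_fun setT (P \- N)%E by exact: emeasurable_funB.
  have <- := ae_eq_integral _ _ measurableT mPN mr ae.
  rewrite integralB// -sv -sw (eq_rsum uvw) rsum_diff// ?sv ?sw//.
  by rewrite EFinB !fineK// ge0_fin_numE// integral_ge0.
Qed.

End integral_rsum.

(** * Measurability of functions of a configuration *)

Section mconfig_measurability.
Context {d : nat}.

Lemma measurable_coordinate (x : site d) (B : set nat) :
  measurable [set eta : mconfig d | B (eta x)].
Proof. by apply: sub_sigma_algebra; exists x, B. Qed.

Lemma measurable_map (s : seq (site d)) (l : seq nat) :
  measurable [set eta : mconfig d | [seq eta x | x <- s] = l].
Proof.
elim: s l => [|x s IH] [|n l] /=.
- by rewrite (_ : [set _ | _] = setT)//; apply/seteqP; split.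
- by rewrite (_ : [set _ | _] = set0)//; apply/seteqP; split.
- by rewrite (_ : [set _ | _] = set0)//; apply/seteqP; split.
rewrite (_ : [set _ | _] = [set eta : mconfig d | eta x = n] `&`
    [set eta : mconfig d | [seq eta x | x <- s] = l]).
  by apply: measurableI => //; exact: (measurable_coordinate x [set n]).
by apply/seteqP; split=> eta /= [-> ->].
Qed.

(** As a finite box has only countably many configurations, a property read off
    a finite box is a countable union of cylinders. *)
Lemma measurable_local (s : seq (site d)) (P : set (mconfig d)) :
  (forall eta zeta : mconfig d, {in s, eta =1 zeta} -> P eta -> P zeta) ->
  measurable P.
Proof.
move=> sP.
pose F (l : seq nat) : set (mconfig d) :=
  if `[<exists2 eta, P eta & [seq eta x | x <- s] = l>]
  then [set eta | [seq eta x | x <- s] = l] else set0.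
rewrite (_ : P = \bigcup_l F l).
  apply: countable_bigcupT_measurable; first exact: countableP.
  by move=> l; rewrite /F; case: ifP => // _; exact: measurable_map.
apply/seteqP; split=> [eta Peta|zeta [l _]].
  exists [seq eta x | x <- s] => //; rewrite /F ifT//.
  by apply/asboolP; exists eta.
rewrite /F; case: ifPn => // /asboolP[eta Peta <-] /= /eq_in_map E.
by apply: (sP eta) => // x xs; rewrite E.
Qed.

Lemma measurable_fun_local d' (T : measurableType d') (s : seq (site d))
    (f : mconfig d -> T) :
  (forall eta zeta : mconfig d, {in s, eta =1 zeta} -> f eta = f zeta) ->
  measurable_fun setT f.
Proof.
move=> sf _ B mB; rewrite setTI; apply: (@measurable_local s).
by move=> eta zeta /sf /= ->.
Qed.

Lemma measurable_fun_mconfig d' (T : measurableType d') (f : T -> mconfig d) :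
  (forall x (B : set nat), measurable [set t | B (f t x)]) ->
  measurable_fun setT f.
Proof.
move=> mf; apply: (@measurability _ _ T (mconfig d) setT f (@cylinder1 d)) => //.
by move=> _ [_ [x [B ->]] <-]; rewrite setTI; exact: mf.
Qed.

Definition box (J : seq (site d)) (B : site d -> set nat) : set (mconfig d) :=
  [set eta | forall x, x \in J -> B x (eta x)].

(** Finite-dimensional cylinders generate the same sigma-algebra as
    one-coordinate ones and are moreover stable under intersection, so finite
    measures that agree on them are equal. *)
Definition boxes : set (set (mconfig d)) :=
  [set A | exists J B, uniq J /\ A = box J B].

Lemma measurable_box J B : measurable (box J B).
Proof.
apply: (@measurable_local J) => eta zeta E Beta x xJ.
by rewrite -E//; exact: Beta.
Qed.

Lemma setI_closed_boxes : setI_closed boxes.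
Proof.
move=> _ _ [J [B [uJ ->]]] [K [C [uK ->]]].
exists (undup (J ++ K)), (fun x => [set n | (x \in J -> B x n) /\ (x \in K -> C x n)]).
split; first exact: undup_uniq.
apply/seteqP; split=> [eta [JB KC] x _|eta JK] /=.
  by split=> [/JB|/KC].
split=> x xJ.
  by have [|+ _] := JK x; [rewrite mem_undup mem_cat xJ|exact].
by have [|_ +] := JK x; [rewrite mem_undup mem_cat xJ orbT|exact].
Qed.

Lemma sigma_boxes : @measurable _ (mconfig d) = <<s boxes >>.
Proof.
apply/seteqP; split.
  apply: smallest_sub; first exact: smallest_sigma_algebra.
  move=> _ [x [B ->]]; apply: sub_sigma_algebra.
  exists [:: x], (fun=> B); split=> //; apply/seteqP; split=> eta /=.
    by move=> ? y; rewrite inE => /eqP ->.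
  by apply; rewrite inE.
apply: smallest_sub; first exact: sigma_algebra_measurable.
by move=> _ [J [B [_ ->]]]; exact: measurable_box.
Qed.

Definition upd (x : site d) (n : nat) (eta : mconfig d) : mconfig d :=
  fun z => if z == x then n else eta z.

Lemma measurable_upd x n :
  measurable_fun setT (upd x n).
Proof.
apply: measurable_fun_mconfig => z B; apply: (@measurable_local [:: z]) => eta zeta E.
by rewrite /= /upd; case: ifP => //; rewrite E// inE.
Qed.

End mconfig_measurability.

(** * Independence of the values at distinct sites *)

Section independence.
Context {R : realType} {d : nat} (nu : probability (mconfig d) R).
Hypotheses (nu_prod : product_probability nu)
  (nu_transl : translation_invariant_probability nu).
Local Notation mu := (marginal nu).

Lemma marginal_site x n : (nu [set eta | eta x = n] = (mu n)%:E)%E.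
Proof.
rewrite /marginal fineK; last first.
  by apply: fin_num_measure; exact: (measurable_coordinate 0 [set n]).
rewrite -(@nu_transl x [set eta | eta 0 = n]).
  by congr (nu _); apply/seteqP; split=> eta /=; rewrite add0r.
exact: (measurable_coordinate 0 [set n]).
Qed.

Lemma marginal_ge0 n : 0 <= mu n.
Proof. by rewrite -lee_fin -(@marginal_site 0 n). Qed.

(** Overwriting the value at x makes a configuration independent of the
    value that was there: both sides are finite measures in A, and they agree
    on finite-dimensional cylinders by the product formula. *)
Lemma upd_independent_set x (n k : nat) (A : set (mconfig d)) : measurable A ->
  (nu ([set eta | eta x = k] `&` (upd x n @^-1` A)) =
   (mu k)%:E * nu (upd x n @^-1` A))%E.
Proof.
have mx : measurable [set eta : mconfig d | eta x = k].
  exact: (measurable_coordinate x [set k]).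
pose m1 : {measure set (mconfig d) -> \bar R} :=
  measure_function_pushforward__canonical__measure_function_Measure
    (mrestr nu mx) (measurable_upd x n).
pose m2 : {measure set (mconfig d) -> \bar R} := mscale (NngNum (marginal_ge0 k))
  (measure_function_pushforward__canonical__measure_function_Measure
    nu (measurable_upd x n)).
suff : forall B, measurable B -> m1 B = m2 B.
  by move=> /(_ A) + mA => /(_ mA); rewrite /m1 /m2 /= /mscale /pushforward /mrestr /= setIC.
apply: (measure_unique boxes (fun=> setT)).
- exact: sigma_boxes.
- exact: setI_closed_boxes.
- move=> _; exists [::], (fun=> setT); split=> //.
  by apply/seteqP; split.
- by apply/seteqP; split=> // eta _; exists 0%N.
- move=> _ [J [B [uJ ->]]].
  rewrite /m1 /m2 /= /mscale /= /pushforward /mrestr /=.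
  have [xJB|xJB] := pselect (x \in J -> B x n); last first.
    have -> : upd x n @^-1` box J B = set0.
      apply/seteqP; split=> // eta /= JB; apply: xJB => xJ.
      by have := JB _ xJ; rewrite /upd eqxx.
    by rewrite set0I !measure0 mule0.
  pose J' := [seq z <- J | z != x].
  have -> : upd x n @^-1` box J B = box J' B.
    apply/seteqP; split=> eta /= JB z.
      rewrite mem_filter => /andP[zx zJ].
      by have := JB _ zJ; rewrite /upd (negbTE zx).
    move=> zJ; rewrite /upd; have [zx|zx] := eqVneq z x.
      by rewrite zx; apply: xJB; rewrite -zx.
    by apply: JB; rewrite mem_filter zx.
  have uJ' : uniq (x :: J').
    by rewrite /= filter_uniq// andbT mem_filter eqxx.
  pose B' z := if z == x then [set k] else B z.
  have -> : box J' B `&` [set eta | eta x = k] = box (x :: J') B'.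
    apply/seteqP; split=> [eta [JB xk] z|eta JB] /=.
      rewrite inE /B'; case: eqVneq => [->//|zx /= zJ]; exact: JB.
    split; last by have := JB x; rewrite /B' eqxx; apply; rewrite inE eqxx.
    move=> z zJ; have := JB z; rewrite /B' inE zJ orbT.
    by move: zJ; rewrite mem_filter => /andP[/negbTE -> _]; exact.
  rewrite (nu_prod B' uJ') big_cons (nu_prod B); last by case/andP: uJ'.
  congr (_ * _)%E; first by rewrite /B' eqxx (@marginal_site x k).
  rewrite [in LHS]big_seq [in RHS]big_seq; apply: eq_bigr => z.
  by rewrite mem_filter /B' => /andP[/negbTE -> _].
- move=> _; rewrite /m1 /= /pushforward /mrestr (@le_lt_trans _ _ 1%E) ?ltry//.
  by apply: probability_le1; rewrite preimage_setT setTI.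
Qed.

Lemma upd_independent x (n k : nat) (f : mconfig d -> \bar R) :
  measurable_fun setT f -> (forall eta, 0 <= f eta)%E ->
  (\int[nu]_(eta in [set eta | eta x = k]) f (upd x n eta) =
   (mu k)%:E * \int[nu]_eta f (upd x n eta))%E.
Proof.
move=> mf f0.
have mx : measurable [set eta : mconfig d | eta x = k].
  exact: (measurable_coordinate x [set k]).
have mu_upd := measurable_upd x n.
pose m1 : {measure set (mconfig d) -> \bar R} := mrestr nu mx.
pose m2 : {measure set (mconfig d) -> \bar R} :=
  mscale (NngNum (marginal_ge0 k)) nu.
have mfu : measurable_fun setT (f \o upd x n) by exact: measurableT_comp.
have -> : (\int[nu]_(eta in [set eta | eta x = k]) f (upd x n eta) =
           \int[m1]_eta f (upd x n eta))%E.
  rewrite [RHS](@ge0_negligible_integral _ _ _ _ _ (~` [set eta : mconfig d | eta x = k]))//.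
  - rewrite setTD setCK; apply: eq_measure_integral => A mA Ax.
    by rewrite /m1 /= /mrestr; congr (nu _); apply/esym/setIidPl.
  - exact: measurableC.
  - by rewrite /m1 /= /mrestr setICl measure0.
have -> : ((mu k)%:E * \int[nu]_eta f (upd x n eta) =
    \int[m2]_eta f (upd x n eta))%E.
  by rewrite /m2 ge0_integral_mscale//.
pose push m : {measure set (mconfig d) -> \bar R} :=
  measure_function_pushforward__canonical__measure_function_Measure m mu_upd.
have E (m : {measure set (mconfig d) -> \bar R}) :
    (\int[m]_eta f (upd x n eta) = \int[push m]_eta f eta)%E.
  by rewrite (ge0_integral_pushforward mu_upd) ?preimage_setT.
rewrite (E m1) (E m2); apply: eq_measure_integral => A mA _.
rewrite /push /m1 /m2 /= /pushforward /= /mrestr /mscale /= -upd_independent_set//.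
by rewrite setIC.
Qed.

End independence.

Section two_sites.
Local Open Scope ereal_scope.
Context {R : realType} {d : nat} (nu : probability (mconfig d) R).
Hypotheses (nu_prod : product_probability nu)
  (nu_transl : translation_invariant_probability nu).
Local Notation mu := (marginal nu).
Implicit Types (x y : site d) (f : mconfig d -> \bar R).

Lemma measurable_fun_at d' (T : measurableType d') x (h : nat -> T) :
  measurable_fun setT (fun eta : mconfig d => h (eta x)).
Proof.
by apply: (@measurable_fun_local _ _ _ [:: x]) => eta zeta E; rewrite E// inE.
Qed.

Lemma measurable_fun_at2 d' (T : measurableType d') x y (h : nat -> nat -> T) :
  measurable_fun setT (fun eta : mconfig d => h (eta x) (eta y)).
Proof.
by apply: (@measurable_fun_local _ _ _ [:: x; y]) => eta zeta E;
  rewrite !E// !inE eqxx ?orbT.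
Qed.

Lemma integral_at_upd x (n k : nat) f : measurable_fun setT f ->
  (forall eta, 0 <= f eta) ->
  \int[nu]_eta ((eta x == k)%:R%:E * f (upd x n eta)) =
  (mu k)%:E * \int[nu]_eta f (upd x n eta).
Proof.
move=> mf f0; rewrite -upd_independent// [RHS]integral_mkcond.
apply: eq_integral => eta _; rewrite /patch.
have [xk|xk] := eqVneq (eta x) k; first by rewrite mem_set// mul1e.
by rewrite memNset ?mul0e//=; exact/eqP.
Qed.

Lemma integral_at2 x y (k l : nat) f : x != y -> measurable_fun setT f ->
  (forall eta, 0 <= f eta) ->
  \int[nu]_eta (((eta x == k) && (eta y == l))%:R%:E * f eta) =
  (mu k * mu l)%:E * \int[nu]_eta f (upd x k (upd y l eta)).
Proof.
move=> xy mf f0.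
have mfk : measurable_fun setT (fun eta => f (upd x k eta)).
  by apply: measurableT_comp => //; exact: measurable_upd.
pose F (eta : mconfig d) : \bar R := (eta y == l)%:R%:E * f eta.
have mF : measurable_fun setT F.
  apply: emeasurable_funM => //.
  exact: (measurable_fun_at y (fun n => ((n == l)%:R : R)%:E)).
transitivity (\int[nu]_eta ((eta x == k)%:R%:E * F (upd x k eta))).
  apply: eq_integral => eta _; rewrite /F.
  have [xk|xk] /= := eqVneq (eta x) k; last by rewrite !mul0e.
  have -> : upd x k eta = eta.
    by apply/funext => z; rewrite /upd; case: eqVneq => // ->.
  by rewrite mul1e.
rewrite (integral_at_upd x k k mF); last by move=> eta; rewrite mule_ge0.
rewrite EFinM -muleA; congr (_ * _).
rewrite -(@integral_at_upd y l l (fun eta => f (upd x k eta)))//.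
apply: eq_integral => eta _; have yx : (y == x) = false by rewrite eq_sym; exact: negbTE.
rewrite /F {1}/upd yx.
have [yl|yl] := eqVneq (eta y) l; last by rewrite !mul0e.
by have -> : upd y l eta = eta;
  first by apply/funext => z; rewrite /upd; case: eqVneq => // ->.
Qed.

(** The values at x and y are independent of the other coordinates, so
    freezing them inside h turns their joint law into weights. *)
Lemma integral_two_sites x y (h : nat -> nat -> mconfig d -> \bar R) : x != y ->
  (forall k l, measurable_fun setT (h k l)) -> (forall k l eta, 0 <= h k l eta) ->
  \int[nu]_eta h (eta x) (eta y) eta =
  \esum_(w in [set: nat * nat])
    ((mu w.1 * mu w.2)%:E * \int[nu]_eta h w.1 w.2 (upd x w.1 (upd y w.2 eta))).
Proof.
move=> xy mh h0.
transitivity (\int[nu]_eta \esum_(w in [set: nat * nat])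
   (((eta x == w.1) && (eta y == w.2))%:R%:E * h w.1 w.2 eta)).
  apply: eq_integral => eta _.
  rewrite (esumID [set (eta x, eta y)])/=; last first.
    by move=> w _; rewrite mule_ge0.
  rewrite setTI esum_set1 /= ?eqxx ?mul1e// esum1 ?adde0//.
  move=> [k l] [_ /=]; case: eqVneq => [<-|_ _]; last by rewrite mul0e.
  by case: eqVneq => [<- //|_ _]; rewrite mul0e.
rewrite integral_esum.
- apply: eq_esum => -[k l] _ /=; exact: integral_at2.
- by move=> w eta; rewrite mule_ge0.
- move=> w; apply: emeasurable_funM => //.
  exact: (measurable_fun_at2 x y
    (fun m n => (((m == w.1) && (n == w.2))%:R : R)%:E)).
Qed.

Lemma integral_one_site x (h : nat -> R) : (forall n, 0 <= h n)%R ->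
  \int[nu]_eta (h (eta x))%:E = \esum_(n in [set: nat]) (h n * mu n)%:E.
Proof.
move=> h0.
transitivity (\int[nu]_eta \esum_(n in [set: nat])
   ((h n)%:E * (\1_[set eta : mconfig d | eta x = n] eta)%:E)).
  apply: eq_integral => eta _.
  rewrite (esumID [set eta x])/=; last first.
    by move=> w _; rewrite mule_ge0// lee_fin.
  rewrite setTI esum_set1 /= ?indicE ?mem_set// ?mule1 ?lee_fin//.
  rewrite esum1 ?adde0// => n [_ /= nx].
  by rewrite indicE memNset ?mule0//= => E; apply: nx.
have mx n : measurable [set eta : mconfig d | eta x = n].
  exact: (measurable_coordinate x [set n]).
have m1 n : measurable_fun setT
    (fun eta : mconfig d => (\1_[set eta : mconfig d | eta x = n] eta : R)%:E).
  by apply/measurable_EFinP; exact: measurable_indic.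
rewrite integral_esum.
- apply: eq_esum => n _; rewrite ge0_integralZl_EFin//.
  rewrite integral_indic// setIT EFinM; congr (_ * _).
  exact: (@marginal_site _ _ _ nu_transl x n).
- by move=> n eta; rewrite mule_ge0// lee_fin.
- by move=> n; exact: measurable_funeM.
Qed.

End two_sites.

(** * Gain and loss of pairs of values *)

Section flows.
Context {R : realType}.
Implicit Types (g : nat -> nat -> nat -> R) (mu : nat -> R).

(** For jumps from x to y under a product measure of marginal mu, inflow g mu k l
    is the rate at which the values at (x, y) become (k, l), and outflow g mu k l
    the rate at which they cease to be (k, l). Working with these rather than
    with A(k, l), which is their difference divided by mu k * mu l, avoids the
    division. *)
Definition inflow g mu (k l : nat) : R :=
  \sum_(0 <= j < l.+1) g j (k + j)%N (l - j)%N * mu (k + j)%N * mu (l - j)%N.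

Definition outflow g mu (k l : nat) : R :=
  (\sum_(0 <= j < k.+1) g j k l) * (mu k * mu l).

Definition net_flow g mu (k l : nat) : R := inflow g mu k l - outflow g mu k l.

End flows.

Section jumps.
Context {d : nat}.

Lemma jump_upd (j k l : nat) (x y : site d) (eta : mconfig d) :
  x != y -> (j <= k)%N ->
  jump j x y (upd x k (upd y l eta)) = upd x (k - j) (upd y (l + j) eta).
Proof.
move=> xy jk; have yx : (y == x) = false by rewrite eq_sym; exact: negbTE.
rewrite /jump {1}/upd eqxx jk xy /=.
apply/funext => z; rewrite /upd !eqxx yx.
by case: (z == x) => //; case: (z == y).
Qed.

Lemma measurable_jump (k : nat) (x y : site d) :
  measurable_fun setT (jump k x y : mconfig d -> mconfig d).
Proof.
apply: measurable_fun_mconfig => z B.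
apply: (@measurable_local _ [:: x; y; z]) => eta zeta E /=.
rewrite /jump -(E x) -?(E y) ?inE ?eqxx ?orbT//.
by case: ifP => _; rewrite -?(E z) ?inE ?eqxx ?orbT.
Qed.

End jumps.

(** Under a product measure, the conditional expectation of f given the values
    k and l at x and y; this formula also makes sense when that event is
    null. *)
Definition condexp {R : realType} {d : nat} (nu : probability (mconfig d) R)
    (f : mconfig d -> R) (x y : site d) (k l : nat) : R :=
  fine (\int[nu]_eta (f (upd x k (upd y l eta)))%:E).

Section flow_integrals.
Local Open Scope ereal_scope.
Context {R : realType} {d : nat} (nu : probability (mconfig d) R).
Hypotheses (nu_prod : product_probability nu)
  (nu_transl : translation_invariant_probability nu).
Context {g : nat -> nat -> nat -> R}.
Hypothesis g_rates : mmp_rates g.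
Local Notation mu := (marginal nu).
Implicit Types (x y : site d).
Local Notation condexp := (condexp nu).

Lemma rate_ge0 k a b : (0 <= g k a b)%R. Proof. by case: g_rates. Qed.

Lemma rate_eq0 k a b : (a < k)%N -> g k a b = 0%R.
Proof. by case: g_rates => _ _ g0 ak; apply: g0; left. Qed.

Local Notation mu_ge0 := (marginal_ge0 nu_transl).

Lemma inflow_ge0 k l : (0 <= inflow g mu k l)%R.
Proof.
by apply: sumr_ge0 => j _; rewrite !mulr_ge0// ?rate_ge0// mu_ge0.
Qed.

Lemma outflow_ge0 k l : (0 <= outflow g mu k l)%R.
Proof.
rewrite mulr_ge0// ?mulr_ge0// ?mu_ge0//.
by apply: sumr_ge0 => j _; exact: rate_ge0.
Qed.

Lemma esum_rate (h : nat -> R) (k l : nat) : (forall j, 0 <= h j)%R ->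
  \esum_(j in [set: nat]) (h j * g j k l)%:E =
  (\sum_(0 <= j < k.+1) h j * g j k l)%:E.
Proof.
move=> h0; have hg j : (0 <= h j * g j k l)%R by rewrite mulr_ge0// rate_ge0.
rewrite -esum_le_nat// (esumID [set j | (j <= k)%N])/=; last first.
  by move=> j _; rewrite lee_fin.
rewrite setTI [X in _ + X]esum1 ?adde0// => j [_ /= /negP].
by rewrite -ltnNge => kj; rewrite rate_eq0// mulr0.
Qed.

Lemma integral_const (c : R) : \int[nu]_eta c%:E = c%:E.
Proof.
rewrite (integral_cst nu measurableT) /= -[RHS]mule1; congr (_ * _).
exact: probability_setT.
Qed.

Section bounded_function.
Context (f : mconfig d -> R) (K : R).
Hypotheses (mf : measurable_fun setT f) (f0 : forall eta, (0 <= f eta)%R)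
  (fK : forall eta, (f eta <= K)%R).

Lemma integral_bounded_fin (h : mconfig d -> mconfig d) :
  measurable_fun setT h ->
  \int[nu]_eta (f (h eta))%:E \is a fin_num.
Proof.
move=> mh; rewrite ge0_fin_numE; last first.
  by apply: integral_ge0 => eta _; rewrite lee_fin.
apply: (@le_lt_trans _ _ (\int[nu]_eta K%:E)).
  apply: ge0_le_integral => //.
  - by move=> eta _; rewrite lee_fin.
  - by apply/measurable_EFinP; exact: measurableT_comp.
  - by move=> eta _; rewrite lee_fin.
by rewrite integral_const ltry.
Qed.

Lemma measurable_upd2 x y k l :
  measurable_fun setT (fun eta : mconfig d => upd x k (upd y l eta)).
Proof.
by apply: (measurableT_comp (f := upd x k)); exact: measurable_upd.
Qed.

Lemma condexpE x y k l : (condexp f x y k l)%:E =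
  \int[nu]_eta (f (upd x k (upd y l eta)))%:E.
Proof.
rewrite /condexp fineK//.
exact: (@integral_bounded_fin (fun eta => upd x k (upd y l eta))
  (measurable_upd2 x y k l)).
Qed.

Lemma condexp_ge0 x y k l : (0 <= condexp f x y k l)%R.
Proof. by apply/fine_ge0/integral_ge0 => eta _; rewrite lee_fin. Qed.

Lemma condexp_le x y k l : (condexp f x y k l <= K)%R.
Proof.
rewrite -lee_fin condexpE.
apply: (@le_trans _ _ (\int[nu]_eta K%:E)).
  apply: ge0_le_integral => //.
  - by move=> eta _; rewrite lee_fin.
  - apply/measurable_EFinP; apply: (measurableT_comp mf).
    exact: measurable_upd2.
  - by move=> eta _; rewrite lee_fin.
by rewrite integral_const.
Qed.

Lemma integral_outflow x y : x != y ->
  \int[nu]_eta (\esum_(j in [set: nat]) (g j (eta x) (eta y) * f eta)%:E) =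
  \esum_(w in [set: nat * nat])
    (outflow g mu w.1 w.2 * condexp f x y w.1 w.2)%:E.
Proof.
move=> xy.
have E k l eta : \esum_(j in [set: nat]) (g j k l * f eta)%:E =
    ((\sum_(0 <= j < k.+1) g j k l) * f eta)%:E.
  under eq_esum do rewrite mulrC.
  by rewrite (@esum_rate (fun=> f eta))// -mulr_sumr mulrC.
under eq_integral do rewrite E.
rewrite (@integral_two_sites _ _ nu nu_prod nu_transl x y
  (fun k l eta => ((\sum_(0 <= j < k.+1) g j k l) * f eta)%:E)) //.
- apply: eq_esum => -[k l] _ /=.
  under eq_integral do rewrite EFinM.
  rewrite ge0_integralZl_EFin//.
  + by rewrite -condexpE -!EFinM mulrA [X in (X * _)%R]mulrC.
  + by move=> eta _; rewrite lee_fin.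
  + apply/measurable_EFinP; apply: (measurableT_comp mf).
    exact: measurable_upd2.
  + by apply: sumr_ge0 => j _; exact: rate_ge0.
- by move=> k l; apply/measurable_EFinP; exact: measurable_funM.
- move=> k l eta; rewrite lee_fin mulr_ge0//.
  by apply: sumr_ge0 => j _; exact: rate_ge0.
Qed.

(** The change of variables: the jumps of j particles that lead to the values
    (k, l) start from (k + j, l - j), and change nothing away from x and y. *)
Lemma integral_inflow x y : x != y ->
  \int[nu]_eta (\esum_(j in [set: nat])
    (g j (eta x) (eta y) * f (jump j x y eta))%:E) =
  \esum_(w in [set: nat * nat])
    (inflow g mu w.1 w.2 * condexp f x y w.1 w.2)%:E.
Proof.
move=> xy.
have mfj j : measurable_fun setT (fun eta : mconfig d => f (jump j x y eta)).
  exact: (measurableT_comp mf (measurable_jump j x y)).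
rewrite (@integral_two_sites _ _ nu nu_prod nu_transl x y
  (fun k l eta => \esum_(j in [set: nat]) (g j k l * f (jump j x y eta))%:E)) //.
- pose t (w : nat * nat) (j : nat) : R :=
    (g j w.1 w.2 * mu w.1 * mu w.2 * condexp f x y (w.1 - j) (w.2 + j))%R.
  have t0 w j : (0 <= t w j)%R.
    by rewrite !mulr_ge0// ?rate_ge0// ?mu_ge0// condexp_ge0.
  transitivity (\esum_(w in [set: nat * nat])
      \esum_(j in [set j | j <= w.1]%N) (t w j)%:E).
    apply: eq_esum => -[k l] _ /=.
    have mfju j : measurable_fun setT
        (fun eta : mconfig d => f (jump j x y (upd x k (upd y l eta)))).
      exact: (measurableT_comp (mfj j) (measurable_upd2 x y k l)).
    rewrite integral_esum; last 2 first.
    + by move=> j eta; rewrite lee_fin mulr_ge0// rate_ge0.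
    + by move=> j; apply/measurable_EFinP; exact: measurable_funM.
    rewrite -esumZl; last 2 first.
    + by rewrite mulr_ge0// mu_ge0.
    + move=> j; apply: integral_ge0 => eta _.
      by rewrite lee_fin mulr_ge0// rate_ge0.
    rewrite (esumID [set j | (j <= k)%N])/=; last first.
      move=> j _; rewrite mule_ge0// ?lee_fin ?mulr_ge0 ?mu_ge0//.
      by apply: integral_ge0 => eta _; rewrite lee_fin mulr_ge0// rate_ge0.
    rewrite setTI [X in _ + X]esum1 ?adde0; last first.
      move=> j [_ /= /negP]; rewrite -ltnNge => kj.
      under eq_integral do rewrite rate_eq0// mul0r.
      by rewrite integral0 mule0.
    apply: eq_esum => j /= jk.
    under eq_integral do rewrite jump_upd// EFinM.
    rewrite ge0_integralZl_EFin ?rate_ge0//; last 2 first.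
    + by move=> eta _; rewrite lee_fin.
    + apply/measurable_EFinP; apply: (measurableT_comp mf).
      exact: measurable_upd2.
    rewrite -condexpE -!EFinM /t /=; congr EFin.
    by rewrite !mulrA; congr (_ * _)%R; rewrite mulrC mulrA.
  rewrite esum_esum; last by move=> *; rewrite lee_fin.
  pose e (z : nat * nat * nat) : nat * nat * nat :=
    ((z.1.1 + z.2, z.1.2 - z.2), z.2)%N.
  rewrite (@reindex_esum _ _ _
    ([set: nat * nat] `*`` (fun w => [set j | j <= w.2]%N)) _ e); last first.
    split.
    + by move=> [[k l] j] /= [_ jl]; split=> //=; exact: leq_addl.
    + move=> [[k l] j] [[k' l'] j'] /[!inE] /= -[_ jl] [_ jl'] [kk ll jj].
      move: kk ll jl; rewrite jj => /addIn -> ll jl.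
      by rewrite -(subnK jl) ll subnK.
    + move=> [[k l] j] /= [_ jk]; exists ((k - j, l + j), j)%N => /=.
        by split=> //=; exact: leq_addl.
      by rewrite /e /= subnK// addnK.
  rewrite -(@esum_esum _ _ _ setT (fun w => [set j | j <= w.2]%N)
     (fun w j => (t (e (w, j)).1 j)%:E)); last by move=> *; rewrite lee_fin.
  apply: eq_esum => -[k l] _ /=.
  rewrite esum_le_nat// /t /= /inflow mulr_suml.
  congr EFin; apply: eq_big_nat => j /andP[_]; rewrite ltnS => jl.
  by rewrite addnK subnK.
- move=> k l; apply: measurable_esum => [j eta|j].
    by rewrite lee_fin mulr_ge0// rate_ge0.
  by apply/measurable_EFinP; exact: measurable_funM.
- by move=> k l eta; apply: esum_ge0 => j _; rewrite lee_fin mulr_ge0// rate_ge0.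
Qed.

End bounded_function.
End flow_integrals.

(** * Transition probability and state space *)

Section transition_kernel.
Context {R : realType} {d : nat} (p : site d -> site d -> R).
Hypotheses (p_prob : transition_probability p) (p_transl : translation_invariant p).

Lemma kernel_ge0 x y : 0 <= p x y. Proof. exact: p_prob.1. Qed.

Lemma kernel_row_sum x : (\esum_(y in [set: site d]) (p x y)%:E = 1)%E.
Proof. exact: p_prob.2. Qed.

(** By translation invariance p(x, y) depends on y - x only, so that the
    counting measure is invariant for p. *)
Lemma kernel_col_sum y : (\esum_(x in [set: site d]) (p x y)%:E = 1)%E.
Proof.
rewrite -(kernel_row_sum 0) [RHS](@reindex_esum _ _ _ setT _ (fun x => y - x)).
  by apply: eq_esum => x _; rewrite -(p_transl 0 (y - x) x) add0r subrK.
split=> //.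
  by move=> x z _ _ /addrI /oppr_inj.
by move=> z _; exists (y - z) => //; rewrite opprB addrC subrK.
Qed.

Lemma kernel_weighted_sum (b : site d -> R) : (forall x, 0 <= b x) ->
  (\esum_(w in [set: site d * site d]) (p w.1 w.2 * b w.1)%:E =
     \esum_(x in [set: site d]) (b x)%:E)%E /\
  (\esum_(w in [set: site d * site d]) (p w.1 w.2 * b w.2)%:E =
     \esum_(x in [set: site d]) (b x)%:E)%E.
Proof.
move=> b0.
have H (q : site d -> site d -> R) : (forall x y, 0 <= q x y) ->
    (forall x, \esum_(y in [set: site d]) (q x y)%:E = 1)%E ->
    (\esum_(w in [set: site d * site d]) (q w.1 w.2 * b w.1)%:E =
     \esum_(x in [set: site d]) (b x)%:E)%E.
  move=> q0 q1.
  rewrite (esum_pair (v := fun w => (q w.1 w.2 * b w.1)%:E)); last first.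
    by move=> w; rewrite lee_fin mulr_ge0.
  apply: eq_esum => x _ /=; under eq_esum do rewrite EFinM.
  by rewrite esumZr// ?q1 ?mul1e// => y; rewrite lee_fin.
split; first by apply: H; [exact: kernel_ge0|exact: kernel_row_sum].
rewrite -(H (fun x y => p y x)); [|move=> *; exact: kernel_ge0|exact: kernel_col_sum].
rewrite (@reindex_esum _ _ _ setT _ (fun w => (w.2, w.1)))//.
split=> //; first by move=> [x y] [z w] _ _ [-> ->].
by move=> [x y] _; exists (y, x).
Qed.

End transition_kernel.

Section state_space.
Context {R : realType} {d : nat} (a : site d -> R).
Hypothesis (a0 : forall x, 0 < a x).

Lemma measurable_cnorm : measurable_fun setT (cnorm a : mconfig d -> \bar R).
Proof.
apply: measurable_esum => [x eta|x].
  by rewrite lee_fin mulr_ge0// ltW.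
exact: (measurable_fun_at x (fun n => (n%:R * a x)%:E)).
Qed.

Lemma measurable_finite_norm : measurable (Defs.finite_norm a : set (mconfig d)).
Proof.
rewrite (_ : Defs.finite_norm a = ~` (cnorm a @^-1` [set +oo%E])).
  apply: measurableC; rewrite -[X in measurable X]setTI.
  by apply: measurable_cnorm => //; exact: emeasurable_set1.
by apply/seteqP; split=> eta /=; rewrite /Defs.finite_norm /= ltey => /eqP.
Qed.

Lemma cdist_jump k x y (eta : config d) :
  (cdist a (jump k x y eta) eta <= (k%:R * (a x + a y))%:E)%E.
Proof.
have b0 z c : 0 <= (c == z :> site d)%:R * (k%:R * a z).
  by rewrite !mulr_ge0// ltW.
apply: (@le_trans _ _ (\esum_(z in [set: site d])
    (((z == x)%:R * (k%:R * a x))%:E + ((z == y)%:R * (k%:R * a y))%:E))%E).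
  apply: le_esum => z _; rewrite -EFinD lee_fin /jump.
  case: ifPn => [/andP[kx xy]|_]; last by rewrite subrr normr0 mul0r addr_ge0.
  have [->|zx] := eqVneq z x.
    rewrite (negbTE xy) mul1r mul0r addr0 natrB// addrAC subrr sub0r normrN.
    by rewrite ger0_norm.
  have [->|zy] := eqVneq z y.
    by rewrite mul0r add0r mul1r natrD addrAC subrr add0r ger0_norm.
  by rewrite subrr normr0 !mul0r addr0.
rewrite esumD; last 2 first.
- by move=> z _; rewrite lee_fin.
- by move=> z _; rewrite lee_fin.
have E z (c : R) : 0 <= c -> (\esum_(i in [set: site d]) ((i == z)%:R * c)%:E = c%:E)%E.
  move=> c0; have [s E] := rsum_single z c.
  have c0' i : 0 <= (i == z)%:R * c by rewrite mulr_ge0.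
  rewrite -[in RHS]E rsum_ge0// ?fineK//; last first.
    by move: s; apply: le_lt_trans; apply: le_esum => i _; rewrite lee_fin ler_norm.
  rewrite ge0_fin_numE; last by apply: esum_ge0 => i _; rewrite lee_fin.
  by move: s; apply: le_lt_trans; apply: le_esum => i _; rewrite lee_fin ler_norm.
by rewrite !E -?EFinD ?mulrDr// mulr_ge0// ltW.
Qed.

Lemma extend0_val (f : state a -> R) (eta : state a) : extend0 f (val eta) = f eta.
Proof. by rewrite /extend0 valK. Qed.

Lemma extend0_out (f : state a -> R) (eta : mconfig d) :
  ~ Defs.finite_norm a eta -> extend0 f eta = 0.
Proof. by move=> X; rewrite /extend0 insubN// memNset. Qed.

(** Lets a property relating a state to the value of f there be proved for
    genuine states only. *)
Lemma extend0_in (f : state a -> R) (P : mconfig d -> R -> Prop) (eta : mconfig d) :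
  Defs.finite_norm a eta -> (forall zeta : state a, P (val zeta) (f zeta)) ->
  P eta (extend0 f eta).
Proof.
by move=> X H; have := H (SigSub (mem_set X)); rewrite -extend0_val.
Qed.

(** A jump of k particles moves a configuration by at most k * (a x + a y). *)
Lemma lipschitz_jump l (F : mconfig d -> R) (eta : state a) k x y :
  lipschitz_with l (fun zeta : state a => F (val zeta)) ->
  `|F (jump k x y (val eta)) - F (val eta)| <= l * (k%:R * (a x + a y)).
Proof.
move=> [l0 /(_ (sjump k x y eta) eta)].
rewrite val_sjump// -lee_fin => /le_trans; apply.
by rewrite EFinM lee_pmul2l// cdist_jump.
Qed.

Lemma generatorE p g (F : mconfig d -> R) (eta : state a) :
  generator p g (fun zeta : state a => F (val zeta)) eta =
  rsum [set w : site d * site d * nat | (0 < w.2)%N] (fun w =>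
    p w.1.1 w.1.2 * g w.2 (val eta w.1.1) (val eta w.1.2) *
    (F (jump w.2 w.1.1 w.1.2 (val eta)) - F (val eta))).
Proof. by apply: eq_rsum => -[[x y] k] _ /=; rewrite val_sjump. Qed.

End state_space.

(** * Moments under the product measure *)

Section moments.
Local Open Scope ereal_scope.
Context {R : realType} {d : nat} (nu : probability (mconfig d) R).
Hypotheses (nu_prod : product_probability nu)
  (nu_transl : translation_invariant_probability nu)
  (nu_moment : finite_first_moment (marginal nu)).
Local Notation mu := (marginal nu).
Local Notation mu_ge0 := (marginal_ge0 nu_transl).

Definition first_moment : R := fine (\esum_(n in [set: nat]) (n%:R * mu n)%:E).

Lemma first_moment_ge0 : (0 <= first_moment)%R.
Proof.
by apply/fine_ge0/esum_ge0 => n _; rewrite lee_fin mulr_ge0// mu_ge0.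
Qed.

Lemma integral_coordinate x : \int[nu]_eta ((eta x)%:R)%:E = first_moment%:E.
Proof.
rewrite (@integral_one_site _ _ nu nu_transl x (fun n => n%:R))// fineK//.
rewrite ge0_fin_numE ?nu_moment// esum_ge0// => n _.
by rewrite lee_fin mulr_ge0// mu_ge0.
Qed.

Section norm.
Context (a : site d -> R).
Hypotheses (a0 : forall x, (0 < a x)%R)
  (a_sum : \esum_(x in [set: site d]) (a x)%:E < +oo).

Lemma integral_cnorm : \int[nu]_eta cnorm a eta < +oo.
Proof.
rewrite integral_esum; last 2 first.
- by move=> x eta; rewrite lee_fin mulr_ge0// ltW.
- by move=> x; exact: (measurable_fun_at x (fun n => (n%:R * a x)%:E)).
have E x : \int[nu]_eta ((eta x)%:R * a x)%:E = first_moment%:E * (a x)%:E.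
  under eq_integral do rewrite mulrC EFinM.
  rewrite ge0_integralZl_EFin//; last 2 first.
  - exact: (measurable_fun_at x (fun n => (n%:R : R)%:E)).
  - exact: ltW.
  by rewrite integral_coordinate muleC.
under eq_esum do rewrite E.
rewrite esumZl ?first_moment_ge0//; last by move=> x; rewrite lee_fin ltW.
by rewrite lte_mul_pinfty// lee_fin first_moment_ge0.
Qed.

Lemma cnorm_ge0 eta : 0 <= cnorm a eta.
Proof. by apply: esum_ge0 => x _; rewrite lee_fin mulr_ge0// ltW. Qed.

Lemma integrable_cnorm : nu.-integrable setT (cnorm a).
Proof.
apply/integrableP; split; first exact: measurable_cnorm.
under eq_integral do rewrite gee0_abs ?cnorm_ge0//.
exact: integral_cnorm.
Qed.

Lemma ae_finite_norm : {ae nu, forall eta, Defs.finite_norm a eta}.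
Proof.
have := integrable_ae measurableT integrable_cnorm.
by apply: filterS => eta /(_ Logic.I); rewrite ge0_fin_numE ?cnorm_ge0.
Qed.

Lemma probability_finite_norm : nu (Defs.finite_norm a) = 1.
Proof.
have mX := measurable_finite_norm a0.
have : nu (~` Defs.finite_norm a) = 0.
  apply/negligibleP; first exact: measurableC.
  exact: ae_finite_norm.
rewrite probability_setC//.
have fX : nu (Defs.finite_norm a) \is a fin_num by exact: fin_num_measure.
by rewrite -(fineK fX) -EFinB => -[/eqP]; rewrite subr_eq0 => /eqP <-.
Qed.

End norm.

Section rates.
Context (g : nat -> nat -> nat -> R) (C : R).
Hypotheses (g_rates : mmp_rates g) (C0 : (0 <= C)%R)
  (g_growth : forall k l : nat, (0 < k)%N ->
    (\sum_(1 <= j < k.+1) j%:R * g j k l <= C * (k + l)%:R)%R).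

Lemma integral_rates_le x y :
  \int[nu]_eta (\esum_(j in [set: nat]) (j%:R * g j (eta x) (eta y))%:E) <=
  (C * (first_moment + first_moment))%:E.
Proof.
apply: (@le_trans _ _ (\int[nu]_eta (C%:E * (((eta x)%:R)%:E + ((eta y)%:R)%:E)))).
  apply: ge0_le_integral => //.
  - by move=> eta _; apply: esum_ge0 => j _; rewrite lee_fin mulr_ge0// (rate_ge0 g_rates).
  - apply: measurable_esum => [j eta|j].
      by rewrite lee_fin mulr_ge0// (rate_ge0 g_rates).
    exact: (measurable_fun_at2 x y (fun k l => (j%:R * g j k l)%:E)).
  - exact: (measurable_fun_at2 x y (fun k l => (C%:E * ((k%:R)%:E + (l%:R)%:E)))).
  - move=> eta _; rewrite (esum_rate g_rates)// -EFinD -EFinM lee_fin.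
    have [->|x0] := posnP (eta x).
      rewrite big_nat1 mul0r mulr_ge0//.
    rewrite big_ltn// mul0r add0r -natrD; exact: g_growth.
rewrite ge0_integralZl_EFin//; last 2 first.
- by move=> eta _; rewrite adde_ge0.
- exact: (measurable_fun_at2 x y (fun k l => (((k%:R)%:E + (l%:R)%:E) : \bar R))).
- rewrite ge0_integralD//.
  + by rewrite !integral_coordinate -EFinD -EFinM.
  + exact: (measurable_fun_at x (fun k => ((k%:R)%:E : \bar R))).
  + exact: (measurable_fun_at y (fun k => ((k%:R)%:E : \bar R))).
Qed.

(** Every jump moves at least one particle, so the linear bound on the mean
    displaced mass also bounds the mean number of jumps, which is the total
    gain and the total loss (the change of variables applied to the constant
    function 1). *)
Lemma esum_flow_lty (x y : site d) : x != y ->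
  \esum_(w in [set: nat * nat]) (inflow g mu w.1 w.2)%:E < +oo /\
  \esum_(w in [set: nat * nat]) (outflow g mu w.1 w.2)%:E < +oo.
Proof.
move=> xy.
have c1 k l : condexp nu (cst 1%R) x y k l = 1%R.
  by rewrite /condexp integral_const.
have m1 : measurable_fun setT (cst 1%R : mconfig d -> R) by exact: measurable_cst.
have fin : \int[nu]_eta (\esum_(j in [set: nat]) (g j (eta x) (eta y) * 1)%:E) < +oo.
  apply: le_lt_trans (le_lt_trans (integral_rates_le x y) (ltry _)).
  apply: ge0_le_integral => //.
  - by move=> eta _; apply: esum_ge0 => j _; rewrite mulr1 lee_fin (rate_ge0 g_rates).
  - apply: measurable_esum => [j eta|j].
      by rewrite mulr1 lee_fin (rate_ge0 g_rates).
    exact: (measurable_fun_at2 x y (fun k l => (g j k l * 1)%:E)).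
  - apply: measurable_esum => [j eta|j].
      by rewrite lee_fin mulr_ge0// (rate_ge0 g_rates).
    exact: (measurable_fun_at2 x y (fun k l => (j%:R * g j k l)%:E)).
  - move=> eta _; apply: le_esum => -[|j] _; rewrite mulr1 lee_fin.
      by case: g_rates => _ -> _; rewrite mulr0.
    by rewrite ler_peMl ?(rate_ge0 g_rates)// ler1n.
have := @integral_inflow _ _ nu nu_prod nu_transl g g_rates (cst 1%R) 1 m1
  (fun=> ler01) (fun=> lexx _) x y xy.
have := @integral_outflow _ _ nu nu_prod nu_transl g g_rates (cst 1%R) 1 m1
  (fun=> ler01) (fun=> lexx _) x y xy.
rewrite /= => Eo Ei.
split; [move: fin; rewrite Ei|move: fin; rewrite Eo];
  by under eq_esum do rewrite c1 mulr1.
Qed.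

End rates.
End moments.

(** * Mean of the generator *)

(** What the jumps from x to y contribute to the mean of the generator applied
    to F. Jumps from a site to itself do nothing, hence the value 0 there. *)
Definition flux {R : realType} {d : nat} (nu : probability (mconfig d) R)
    (g : nat -> nat -> nat -> R) (F : mconfig d -> R) (x y : site d) : R :=
  if x == y then 0 else
  rsum [set: nat * nat] (fun w =>
    net_flow g (marginal nu) w.1 w.2 * condexp nu F x y w.1 w.2).

Section generator_integral.
Context {R : realType} {d : nat} (p : site d -> site d -> R)
  (g : nat -> nat -> nat -> R) (C : R) (a : site d -> R)
  (nu : probability (mconfig d) R).
Hypotheses (p_prob : transition_probability p) (p_transl : translation_invariant p)
  (g_rates : mmp_rates g) (C0 : 0 <= C)
  (g_growth : forall k l : nat, (0 < k)%N ->
    (\sum_(1 <= j < k.+1) j%:R * g j k l <= C * (k + l)%:R)%R)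
  (a0 : forall x, 0 < a x)
  (a_sum : (\esum_(x in [set: site d]) (a x)%:E < +oo)%E)
  (nu_prod : product_probability nu)
  (nu_transl : translation_invariant_probability nu)
  (nu_moment : finite_first_moment (marginal nu)).
Local Notation mu := (marginal nu).
Local Notation m1 := (first_moment nu).

Context (F : mconfig d -> R) (K l : R).
Hypotheses (mF : measurable_fun setT F) (F0 : forall eta, 0 <= F eta)
  (FK : forall eta, F eta <= K)
  (Flip : lipschitz_with l (fun zeta : state a => F (val zeta))).

Let V (x y : site d) (k : nat) (eta : mconfig d) : R :=
  g k (eta x) (eta y) * (F (jump k x y eta) - F eta).

Let mFj k x y : measurable_fun setT (fun eta : mconfig d => F (jump k x y eta)).
Proof. exact: (measurableT_comp mF (measurable_jump k x y)). Qed.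

Let mg k (x y : site d) :
  measurable_fun setT (fun eta : mconfig d => g k (eta x) (eta y)).
Proof. exact: (measurable_fun_at2 x y (g k)). Qed.

Let mV x y k : measurable_fun setT (V x y k).
Proof. by apply: measurable_funM => //; exact: measurable_funB. Qed.

Let l_ge0 : 0 <= l. Proof. exact: ltW Flip.1. Qed.

Let a_ge0 x : 0 <= a x. Proof. exact: ltW. Qed.

Let g_ge0 k i j : 0 <= g k i j. Proof. exact: rate_ge0. Qed.

Let bound x y : R := l * (a x + a y) * (C * (m1 + m1)).

(** A jump of k particles changes F by at most l * (k * (a x + a y)), and the
    mean displaced mass is bounded by a multiple of the first moment. *)
Let norm_jump_le x y :
  (\esum_(k in [set: nat]) \int[nu]_eta `|V x y k eta|%:E <= (bound x y)%:E)%E.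
Proof.
have laa : 0 <= l * (a x + a y) by rewrite mulr_ge0 ?addr_ge0.
have mkg k : measurable_fun setT
    (fun eta : mconfig d => (k%:R * g k (eta x) (eta y))%:E).
  exact: (measurable_fun_at2 x y (fun i j => (k%:R * g k i j)%:E)).
apply: (@le_trans _ _ (\esum_(k in [set: nat])
    ((l * (a x + a y))%:E * \int[nu]_eta (k%:R * g k (eta x) (eta y))%:E)%E)).
  apply: le_esum => k _; rewrite -ge0_integralZl_EFin//; last first.
    by move=> eta _; rewrite lee_fin mulr_ge0.
  apply: ae_ge0_le_integral => //.
  - by apply/measurable_EFinP; exact: measurableT_comp.
  - by move=> eta _; rewrite -EFinM lee_fin mulr_ge0// mulr_ge0.
  - by apply: measurable_funeM.
  have := ae_finite_norm nu_transl nu_moment a0 a_sum.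
  apply: (@filterS _ _ (ae_filter_ringOfSetsType nu)) => eta X _.
  rewrite -EFinM lee_fin /V normrM ger0_norm// [leLHS]mulrC.
  have := lipschitz_jump a0 (SigSub (mem_set X)) k x y Flip.
  move=> /= /(ler_wpM2r (g_ge0 k (eta x) (eta y))) /le_trans; apply.
  by rewrite [X in l * X]mulrC !mulrA.
rewrite esumZl//; last first.
  by move=> k; apply: integral_ge0 => eta _; rewrite lee_fin mulr_ge0.
rewrite -integral_esum//; last by move=> k eta; rewrite lee_fin mulr_ge0.
rewrite /bound [X in (_ <= X)%E]EFinM lee_wpmul2l// ?lee_fin//.
exact: integral_rates_le.
Qed.

Let fin_V x y k : (\int[nu]_eta `|V x y k eta|%:E < +oo)%E.
Proof.
apply: le_lt_trans (le_lt_trans (norm_jump_le x y) (ltry _)).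
rewrite [leRHS](esumID [set k])/=; last first.
  by move=> j _; apply: integral_ge0 => eta _; rewrite lee_fin.
rewrite setTI esum_set1; last by apply: integral_ge0 => eta _; rewrite lee_fin.
by rewrite leeDl// esum_ge0// => j _; apply: integral_ge0 => eta _; rewrite lee_fin.
Qed.

Let e x y k : R := fine (\int[nu]_eta (V x y k eta)%:E).

Let e_le x y k : `|e x y k| <= fine (\int[nu]_eta `|V x y k eta|%:E).
Proof.
have [_ _ E] := integral_posneg (mV x y k) (fin_V x y k).
have fV : (\int[nu]_eta (V x y k eta)%:E)%E \is a fin_num by rewrite E.
rewrite -lee_fin fineK; last first.
  rewrite ge0_fin_numE ?fin_V//.
  by apply: integral_ge0 => eta _; rewrite lee_fin.
rewrite -abse_EFin /e fineK//.
have /= := @le_abse_integral _ _ _ nu setT (fun eta => (V x y k eta)%:E) measurableT.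
by apply; exact/measurable_EFinP.
Qed.

Let summable_e x y : rsummable setT (e x y).
Proof.
apply: (le_rsummable (fun k _ => e_le x y k)).
apply: le_lt_trans (le_lt_trans (norm_jump_le x y) (ltry _)).
apply: le_esum => k _; rewrite fineK// ge0_fin_numE ?fin_V//.
by apply: integral_ge0 => eta _; rewrite lee_fin.
Qed.

Let rsum_e_le x y : `|rsum setT (e x y)| <= bound x y.
Proof.
have fin : (\esum_(k in [set: nat]) (fine (\int[nu]_eta `|V x y k eta|%:E))%:E <=
    (bound x y)%:E)%E.
  apply: le_trans (norm_jump_le x y); apply: le_esum => k _.
  rewrite fineK// ge0_fin_numE ?fin_V//.
  by apply: integral_ge0 => eta _; rewrite lee_fin.
apply: le_trans (ler_norm_rsum (fun k _ => e_le x y k) (le_lt_trans fin (ltry _))) _.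
rewrite -lee_fin fineK// ge0_fin_numE; first exact: le_lt_trans fin (ltry _).
apply: esum_ge0 => k _; rewrite lee_fin fine_ge0//.
by apply: integral_ge0 => eta _; rewrite lee_fin.
Qed.

(** F after the jump is integrated against the gains, F before the jump
    against the losses. *)
Let rsum_e x y : rsum setT (e x y) = flux nu g F x y.
Proof.
rewrite /flux; case: eqVneq => [->|xy].
  rewrite (@eq_rsum _ _ _ _ (fun=> 0)) ?rsum0// => k _.
  rewrite /e /V; under eq_integral do rewrite /jump eqxx andbF subrr mulr0.
  by rewrite integral0.
have [si so] := esum_flow_lty nu_prod nu_transl nu_moment g_rates C0 g_growth xy.
have K0 : 0 <= K by exact: le_trans (F0 (fun=> 0%N)) (FK _).
pose A k := (\int[nu]_eta (g k (eta x) (eta y) * F (jump k x y eta))%:E)%E.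
pose B k := (\int[nu]_eta (g k (eta x) (eta y) * F eta)%:E)%E.
have A0 k : (0 <= A k)%E.
  by apply: integral_ge0 => eta _; rewrite lee_fin mulr_ge0.
have B0 k : (0 <= B k)%E.
  by apply: integral_ge0 => eta _; rewrite lee_fin mulr_ge0.
have cK k j : 0 <= condexp nu F x y k j <= K.
  by rewrite (condexp_ge0 _ F0) (condexp_le _ mF F0 FK).
have small (h : nat * nat -> R) : (forall w, 0 <= h w) ->
    (\esum_(w in [set: nat * nat]) (h w)%:E < +oo)%E ->
    (\esum_(w in [set: nat * nat]) (h w * condexp nu F x y w.1 w.2)%:E < +oo)%E.
  move=> h0 sh; apply: (@le_lt_trans _ _ (\esum_(w in [set: nat * nat])
      (K%:E * (h w)%:E)%E)).
    apply: le_esum => w _; rewrite -EFinM lee_fin mulrC ler_wpM2r//.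
    by case/andP: (cK w.1 w.2).
  by rewrite esumZl// ?lte_mul_pinfty// => w; rewrite lee_fin.
have i0 w : 0 <= inflow g mu w.1 w.2 by exact: inflow_ge0.
have o0 w : 0 <= outflow g mu w.1 w.2 by exact: outflow_ge0.
have sA : (\esum_(k in [set: nat]) A k = \esum_(w in [set: nat * nat])
    (inflow g mu w.1 w.2 * condexp nu F x y w.1 w.2)%:E)%E.
  rewrite -(integral_inflow nu_prod nu_transl g_rates mF F0 FK xy) integral_esum//.
  - by move=> k eta; rewrite lee_fin mulr_ge0.
  - by move=> k; apply/measurable_EFinP; exact: measurable_funM.
have sB : (\esum_(k in [set: nat]) B k = \esum_(w in [set: nat * nat])
    (outflow g mu w.1 w.2 * condexp nu F x y w.1 w.2)%:E)%E.
  rewrite -(integral_outflow nu_prod nu_transl g_rates mF F0 FK xy) integral_esum//.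
  - by move=> k eta; rewrite lee_fin mulr_ge0.
  - by move=> k; apply/measurable_EFinP; exact: measurable_funM.
have fin (h : nat -> \bar R) k : (forall k, 0 <= h k)%E ->
    (\esum_(k in [set: nat]) h k < +oo)%E -> (h k < +oo)%E.
  move=> h0; apply: le_lt_trans; rewrite [leRHS](esumID [set k])//= setTI esum_set1//.
  by rewrite leeDl// esum_ge0.
have fA k : A k \is a fin_num.
  by rewrite ge0_fin_numE//; apply: fin => //; rewrite sA small.
have fB k : B k \is a fin_num.
  by rewrite ge0_fin_numE//; apply: fin => //; rewrite sB small.
have eAB k : [set: nat] k -> e x y k = fine (A k) - fine (B k).
  move=> _; rewrite /e -fineB//; congr fine.
  rewrite -integralB_EFin//.
  - by apply: eq_integral => eta _; rewrite /V mulrBr EFinB.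
  - apply/integrableP; split; first by apply/measurable_EFinP; exact: measurable_funM.
    rewrite (eq_integral (fun eta : mconfig d =>
        (g k (eta x) (eta y) * F (jump k x y eta))%:E)).
      by move: (fA k); rewrite ge0_fin_numE.
    by move=> eta _; rewrite gee0_abs// lee_fin mulr_ge0.
  - apply/integrableP; split; first by apply/measurable_EFinP; exact: measurable_funM.
    rewrite (eq_integral (fun eta : mconfig d => (g k (eta x) (eta y) * F eta)%:E)).
      by move: (fB k); rewrite ge0_fin_numE.
    by move=> eta _; rewrite gee0_abs// lee_fin mulr_ge0.
have fineA : (\esum_(k in [set: nat]) (fine (A k))%:E = \esum_(k in [set: nat]) A k)%E.
  by apply: eq_esum => k _; rewrite fineK.
have fineB : (\esum_(k in [set: nat]) (fine (B k))%:E = \esum_(k in [set: nat]) B k)%E.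
  by apply: eq_esum => k _; rewrite fineK.
rewrite (eq_rsum eAB) rsum_diff ?fineA ?fineB ?sA ?sB ?small//; last 2 first.
- by move=> k; exact: fine_ge0.
- by move=> k; exact: fine_ge0.
under [RHS]eq_rsum do rewrite /net_flow mulrBl.
rewrite rsum_diff ?small// => w; rewrite mulr_ge0//.
  by case/andP: (cK w.1 w.2).
by case/andP: (cK w.1 w.2).
Qed.

Lemma flux_le x y : `|flux nu g F x y| <= l * (a x + a y) * (C * (m1 + m1)).
Proof. by rewrite -rsum_e rsum_e_le. Qed.

(** The bounds on the jumps are summable over pairs of sites, as p is stochastic
    in each of its variables and a is summable: the integral can be taken
    inside the sum defining the generator. *)
Lemma integral_generator :
  rsummable setT (fun w : site d * site d => p w.1 w.2 * flux nu g F w.1 w.2) /\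
  (\int[nu]_eta (extend0 (generator p g (fun zeta : state a => F (val zeta))) eta)%:E =
   (rsum setT (fun w : site d * site d => p w.1 w.2 * flux nu g F w.1 w.2))%:E)%E.
Proof.
pose u (w : site d * site d * nat) (eta : mconfig d) : R :=
  p w.1.1 w.1.2 * V w.1.1 w.1.2 w.2 eta.
have mu_ w : measurable_fun setT (u w) by apply: measurable_funM.
have p0 x y : 0 <= p x y by exact: kernel_ge0.
have iu w : (\int[nu]_eta `|u w eta|%:E =
    (p w.1.1 w.1.2)%:E * \int[nu]_eta `|V w.1.1 w.1.2 w.2 eta|%:E)%E.
  rewrite -ge0_integralZl_EFin//.
  - by apply: eq_integral => eta _; rewrite /u normrM ger0_norm.
  - by apply/measurable_EFinP; exact: measurableT_comp.
have su : (\esum_(w in [set: site d * site d * nat])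
    \int[nu]_eta `|u w eta|%:E < +oo)%E.
  under eq_esum do rewrite iu.
  rewrite (@esum_pair _ _ _ (fun w : site d * site d * nat => (p w.1.1 w.1.2)%:E *
    \int[nu]_eta `|V w.1.1 w.1.2 w.2 eta|%:E)%E); last first.
    by move=> w; rewrite mule_ge0 ?lee_fin// integral_ge0.
  pose c := l * (C * (m1 + m1)).
  have c0 : 0 <= c by rewrite !mulr_ge0// addr_ge0 ?first_moment_ge0.
  apply: (@le_lt_trans _ _ (\esum_(z in [set: site d * site d])
      (c%:E * (p z.1 z.2 * a z.1)%:E + c%:E * (p z.1 z.2 * a z.2)%:E)%E)).
    apply: le_esum => -[x y] _ /=; rewrite esumZl//; last first.
      by move=> k; exact: integral_ge0.
    apply: (@le_trans _ _ ((p x y)%:E * (bound x y)%:E)%E).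
      by rewrite lee_wpmul2l// lee_fin.
    by rewrite -!EFinM -EFinD lee_fin /bound /c le_eqVlt; apply/orP; left;
      apply/eqP; ring.
  have [E1 E2] := kernel_weighted_sum p_prob p_transl a_ge0.
  rewrite esumD; last 2 first.
  - by move=> z _; rewrite -EFinM lee_fin mulr_ge0// mulr_ge0.
  - by move=> z _; rewrite -EFinM lee_fin mulr_ge0// mulr_ge0.
  rewrite !esumZl//; last 2 first.
  - by move=> z; rewrite lee_fin mulr_ge0.
  - by move=> z; rewrite lee_fin mulr_ge0.
  by rewrite E1 E2 lte_add_pinfty// lte_mul_pinfty.
have [mr sr ir] := integral_rsum mu_ su.
have eu w : fine (\int[nu]_eta (u w eta)%:E) = p w.1.1 w.1.2 * e w.1.1 w.1.2 w.2.
  have [_ _ E] := integral_posneg (mV w.1.1 w.1.2 w.2) (fin_V w.1.1 w.1.2 w.2).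
  rewrite (eq_integral (fun eta => (p w.1.1 w.1.2)%:E *
     (V w.1.1 w.1.2 w.2 eta)%:E)%E); last by move=> eta _; rewrite /u EFinM.
  rewrite integralZl//.
    by rewrite fineM// E.
  apply/integrableP; split; first exact/measurable_EFinP.
  exact: fin_V.
have pe z : rsum setT (fun k => fine (\int[nu]_eta (u (z, k) eta)%:E)) =
    p z.1 z.2 * flux nu g F z.1 z.2.
  rewrite -rsum_e -rsumZ; last exact: summable_e.
  by apply: eq_rsum => k _; rewrite eu.
have [_ s2 r2] := rsum_pair sr.
split.
  by move: s2; congr rsummable; apply/funext => z; rewrite pe.
have -> : rsum setT (fun w : site d * site d => p w.1 w.2 * flux nu g F w.1 w.2) =
    rsum setT (fun w => fine (\int[nu]_eta (u w eta)%:E)).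
  by rewrite r2; apply: eq_rsum => z _; rewrite pe.
rewrite -ir.
have gE (eta : mconfig d) :
    extend0 (generator p g (fun zeta : state a => F (val zeta))) eta =
    ((fun eta => rsum setT (u ^~ eta)) \_ (Defs.finite_norm a)) eta.
  rewrite /patch; case: ifPn => [|nX]; last first.
    by apply: extend0_out; move/negP : nX; rewrite inE.
  rewrite inE => X.
  apply: (extend0_in (P := fun eta r => r = rsum setT (u ^~ eta)) X) => zeta.
  rewrite generatorE// rsum_restrict.
    by apply: eq_rsum => w _; rewrite /u /V mulrA.
  move=> [[x y] k] /= /negP; rewrite -leqNgt leqn0 => /eqP ->.
  by case: g_rates => _ -> _; rewrite mulr0 mul0r.
apply: ae_eq_integral => //.
- apply/measurable_EFinP; rewrite (funext gE).
  apply/(measurable_restrictT _ (measurable_finite_norm a0)).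
  exact: measurable_funTS.
- exact/measurable_EFinP.
have := ae_finite_norm nu_transl nu_moment a0 a_sum.
apply: (@filterS _ _ (ae_filter_ringOfSetsType nu)) => eta X _.
by rewrite gE /patch mem_set.
Qed.

End generator_integral.

(** * Invariance and the mean of the generator *)

Section lipschitz_measurable.
Context {R : realType} {d : nat} (a : site d -> R).
Hypothesis (a0 : forall x, 0 < a x).

Definition cutoff (n : nat) (eta : mconfig d) : mconfig d :=
  fun x => if (pickle x < n)%N then eta x else 0%N.

Lemma finite_norm_cutoff n (eta : mconfig d) :
  Defs.finite_norm a eta -> Defs.finite_norm a (cutoff n eta).
Proof.
apply: le_lt_trans; apply: le_esum => x _; rewrite lee_fin ler_wpM2r ?(ltW (a0 _))//.
by rewrite ler_nat /cutoff; case: ifP.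
Qed.

(** The distance to the truncation is a remainder of the convergent series that
    defines the norm. *)
Lemma cdist_cutoff_cvg (eta : mconfig d) : Defs.finite_norm a eta ->
  cdist a eta (cutoff n eta) @[n --> \oo] --> 0%E.
Proof.
move=> X.
pose u k : \bar R := oapp (fun x => ((eta x)%:R * a x)%:E) 0%E (@pickle_inv (site d) k).
have u0 k : (0 <= u k)%E.
  rewrite /u; case: (@pickle_inv (site d) k) => //= x.
  by rewrite lee_fin mulr_ge0// ltW.
have su : (\sum_(0 <= k <oo) u k < +oo)%E.
  move: X; rewrite /Defs.finite_norm /= /cnorm esum_countType => [|x]; last first.
    by rewrite lee_fin mulr_ge0// ltW.
  apply: le_lt_trans; rewrite le_eqVlt; apply/orP; left; apply/eqP.
  apply: eq_eseriesr => k _; rewrite /u.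
  by case: (@pickle_inv (site d) k) => //= x; rewrite in_setT.
suff E n : cdist a eta (cutoff n eta) = (\sum_(n <= k <oo) u k)%E.
  by rewrite (funext E); exact: nneseries_tail_cvg.
rewrite /cdist esum_countType => [|x]; last by rewrite lee_fin mulr_ge0// ltW.
rewrite [RHS]eseries_cond [RHS]eseries_mkcond; apply: eq_eseriesr => k _ /=.
rewrite /u; have := @pickle_invK (site d) k.
case: (@pickle_inv (site d) k) => [x|] /=; last by rewrite if_same.
move=> <-; rewrite in_setT /cutoff ltnNge; case: leqP => xn /=.
  by rewrite subr0 ger0_norm.
by rewrite subrr normr0 mul0r.
Qed.

(** A Lipschitz function is the pointwise limit of its values at finitely
    supported truncations, each of which reads finitely many coordinates. *)
Lemma measurable_extend0 (f : state a -> R) : Lip f ->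
  measurable_fun setT (extend0 f).
Proof.
move=> [l [l0 flip]].
have mX := measurable_finite_norm a0.
have -> : extend0 f = (extend0 f) \_ (Defs.finite_norm a).
  apply/funext => eta; rewrite /patch; case: ifPn => // /negP.
  by rewrite inE => nX; rewrite extend0_out.
apply/(measurable_restrictT _ mX).
apply: (@measurable_fun_cvg _ _ _ _ (fun n eta => extend0 f (cutoff n eta))).
  move=> n; apply: measurable_funTS.
  apply: (@measurable_fun_local _ _ _ (pmap (@pickle_inv (site d)) (iota 0 n))).
  move=> eta zeta E; congr (extend0 f _); apply/funext => x.
  rewrite /cutoff; case: ltnP => // xn; apply: E.
  by rewrite mem_pmap; apply/mapP; exists (pickle x); rewrite ?mem_iota// pickleK_inv.
move=> eta X; apply/cvgrPdist_le => /= e e0.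
have le0 : 0 < e / l by rewrite divr_gt0.
have := cdist_cutoff_cvg X => /fine_cvgP[fin /cvgrPdist_le /(_ _ le0)].
move=> H; near=> n.
pose s1 : state a := SigSub (mem_set X).
pose s2 : state a := SigSub (mem_set (finite_norm_cutoff n X)).
have := flip s1 s2; rewrite -!extend0_val /=.
have fn : cdist a eta (cutoff n eta) \is a fin_num by near: n.
rewrite -(fineK fn) -EFinM lee_fin => /le_trans; apply.
have : `|0 - fine (cdist a eta (cutoff n eta))| <= e / l by near: n.
rewrite sub0r normrN ger0_norm; last first.
  by apply/fine_ge0/esum_ge0 => x _; rewrite lee_fin mulr_ge0// ltW.
by rewrite ler_pdivlMr// mulrC.
Unshelve. all: by end_near. Qed.

End lipschitz_measurable.

Section zero_derivative.
Context {R : realType}.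

(** For any slope e > 0, the largest s below a given bound such that
    |phi s - phi 0| <= e * s can be increased using the right derivative at s,
    unless it is the bound itself; increments along a single sequence suffice
    for this. *)
Lemma zero_right_derivative (phi : R -> R) :
  (forall (u : nat -> R) (t : R), (forall n, 0 <= u n) -> u n @[n --> \oo] --> t ->
    phi (u n) @[n --> \oo] --> phi t) ->
  (forall t : R, 0 <= t ->
    (phi (t + n.+1%:R^-1) - phi t) * n.+1%:R @[n --> \oo] --> 0) ->
  forall t : R, 0 <= t -> phi t = phi 0.
Proof.
move=> cphi dphi T; rewrite le_eqVlt => /predU1P[<-//|T0].
suff H e : 0 < e -> `|phi T - phi 0| <= e * T.
  apply/eqP; rewrite -subr_eq0 -normr_le0; apply/ler_addgt0Pr => e e0.
  by rewrite add0r (le_trans (H (e / T) _)) ?divr_gt0// divfK ?gt_eqF.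
move=> e0.
pose A : set R := [set s | 0 <= s <= T /\ `|phi s - phi 0| <= e * s].
have A0 : A 0 by rewrite /A /= lexx ltW// subrr normr0 mulr0.
have supA : has_sup A.
  by split; [exists 0|exists T => s [/andP[]]].
pose tau := sup A.
have tau0 : 0 <= tau by apply: ub_le_sup => //; exact: supA.2.
have tauT : tau <= T by apply: ge_sup => //; [exact: supA.1|move=> s [/andP[]]].
(* The set A is closed, by continuity of phi. *)
have Atau : A tau.
  split; first by rewrite tau0 tauT.
  have /choice[u uP] : forall n : nat, exists s, A s /\ tau - n.+1%:R^-1 < s.
    move=> n; have n0 : 0 < n.+1%:R^-1 :> R by rewrite invr_gt0.
    by have [s As st] := sup_adherent n0 supA; exists s.
  have utau : u n @[n --> \oo] --> tau.
    apply/cvgrPdist_le => e' e'0.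
    have := @cvg_harmonic R => /cvgrPdist_le /(_ _ e'0) H.
    near=> n; have [Au un] := uP n.
    have ut : u n <= tau by apply: ub_le_sup => //; exact: supA.2.
    rewrite ger0_norm ?subr_ge0//.
    have : `|0 - n.+1%:R^-1 : R| <= e' by near: n.
    rewrite sub0r normrN ger0_norm ?invr_ge0// => hn.
    by move: un; rewrite ltrBlDr lerBlDl => /ltW /le_trans; apply; rewrite lerD2l.
  have u0 n : 0 <= u n by have [[/andP[]]] := uP n.
  have c1 := cphi u tau u0 utau.
  have : (e * u n - `|phi (u n) - phi 0|) @[n --> \oo] --> e * tau - `|phi tau - phi 0|.
    apply: cvgB; first exact: cvgMr.
    by apply: cvg_norm; apply: cvgB => //; exact: cvg_cst.
  move=> c; rewrite -subr_ge0 -(cvg_lim _ c)//; apply: limr_ge.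
    by apply/cvg_ex; exists (e * tau - `|phi tau - phi 0|).
  by apply: nearW => n; rewrite /= subr_ge0; case: (uP n) => -[].
(* Otherwise the right derivative at tau gives a point of A beyond tau. *)
suff -> : T = tau by case: Atau.
apply/eqP; rewrite eq_le tauT andbT leNgt; apply/negP => tT.
have dT : 0 < T - tau by rewrite subr_gt0.
have := dphi _ tau0 => /cvgrPdist_le /(_ _ e0) [N1 _ H1].
have := @cvg_harmonic R => /cvgrPdist_le /(_ _ dT) [N2 _ H2].
pose n := maxn N1 N2.
have {}H1 := H1 n (leq_maxl _ _); have {}H2 := H2 n (leq_maxr _ _).
pose h : R := n.+1%:R^-1.
have h0 : 0 < h by rewrite invr_gt0.
have hT : h <= T - tau by move: H2; rewrite /= sub0r normrN ger0_norm// ltW.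
have hphi : `|phi (tau + h) - phi tau| <= e * h.
  move: H1; rewrite /= sub0r normrN normrM [`|n.+1%:R|]ger0_norm//.
  by rewrite -ler_pdivlMr// mulrC.
have : A (tau + h).
  split; first by apply/andP; split; lra.
  rewrite (le_trans (ler_distD (phi tau) _ _))// mulrDr addrC lerD//.
  by case: Atau.
move=> /(ub_le_sup supA.2); rewrite -/tau; lra.
Unshelve. all: by end_near. Qed.

End zero_derivative.

Section invariance.
Context {R : realType} {d : nat} (p : site d -> site d -> R)
  (g : nat -> nat -> nat -> R) (a : site d -> R)
  (S : R -> (state a -> R) -> (state a -> R))
  (nu : probability (mconfig d) R).
Hypotheses (a0 : forall x, 0 < a x)
  (a_sum : (\esum_(x in [set: site d]) (a x)%:E < +oo)%E)
  (S_semigroup : markov_semigroup p g S)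
  (nu_transl : translation_invariant_probability nu)
  (nu_moment : finite_first_moment (marginal nu)).
Implicit Types (f : state a -> R).

Let mX := measurable_finite_norm a0.

Lemma Lip_cst (c : R) : Lip (fun _ : state a => c).
Proof.
exists 1; split=> // eta zeta; rewrite subrr normr0 mul1e.
by apply: esum_ge0 => x _; rewrite lee_fin mulr_ge0// ltW.
Qed.

Lemma Lip_linear (b : R) f h : Lip f -> Lip h ->
  Lip (fun zeta => b * f zeta + h zeta).
Proof.
move=> [l1 [l10 H1]] [l2 [l20 H2]]; exists (`|b| * l1 + l2); split.
  by rewrite ltr_wpDl// mulr_ge0// ltW.
move=> eta zeta.
have D0 : (0 <= cdist a (val eta) (val zeta))%E.
  by apply: esum_ge0 => x _; rewrite lee_fin mulr_ge0// ltW.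
rewrite EFinD ge0_muleDl ?lee_fin ?mulr_ge0// ?(ltW l10)// ?(ltW l20)//.
apply: (@le_trans _ _ ((`|b| * `|f eta - f zeta|)%:E + `|h eta - h zeta|%:E)%E).
  rewrite -EFinD lee_fin -normrM mulrBr opprD addrACA.
  exact: ler_normD.
by rewrite leeD// !EFinM -muleA lee_wpmul2l// lee_fin.
Qed.

Lemma semigroup_cst (t c : R) eta : 0 <= t -> S t (fun=> c) eta = c.
Proof.
move=> t0; have := sg_linear S_semigroup (c - 1) eta t0 (Lip_cst 1) (Lip_cst 1).
by rewrite (sg_one S_semigroup)// mulr1 subrK.
Qed.

Lemma semigroup_bounded (t K : R) f : 0 <= t -> Lip f ->
  (forall eta, `|f eta| <= K) -> forall eta, `|S t f eta| <= K.
Proof.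
move=> t0 lf fK eta; rewrite ler_norml; apply/andP; split.
  rewrite -subr_ge0 opprK.
  have := sg_linear S_semigroup 1 eta t0 lf (Lip_cst K).
  rewrite semigroup_cst// mul1r => <-.
  apply: (sg_ge0 S_semigroup) => //; first by apply: Lip_linear => //; exact: Lip_cst.
  by move=> zeta; have := fK zeta; rewrite mul1r ler_norml => /andP[]; lra.
rewrite -subr_ge0.
have := sg_linear S_semigroup (-1) eta t0 lf (Lip_cst K).
rewrite semigroup_cst// mulN1r addrC => <-.
apply: (sg_ge0 S_semigroup) => //; first by apply: Lip_linear => //; exact: Lip_cst.
by move=> zeta; have := fK zeta; rewrite mulN1r ler_norml => /andP[]; lra.
Qed.

Definition mean f : R := fine (\int[nu]_eta (extend0 f eta)%:E).

Lemma integral_extend0 f :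
  (\int[nu]_eta (extend0 f eta)%:E =
   \int[nu]_(eta in Defs.finite_norm a) (extend0 f eta)%:E)%E.
Proof.
rewrite [RHS]integral_mkcond; apply: eq_integral => eta _.
rewrite /patch; case: ifPn => // /negP; rewrite inE => nX.
by rewrite extend0_out.
Qed.

Lemma extend0_bounded f (K : R) : (forall eta, `|f eta| <= K) -> 0 <= K ->
  forall eta, `|extend0 f eta| <= K.
Proof.
move=> fK K0 eta; have [X|nX] := pselect (Defs.finite_norm a eta).
  by apply: (extend0_in (P := fun _ r => `|r| <= K) X).
by rewrite extend0_out// normr0.
Qed.

Lemma integrable_extend0 f (K : R) : Lip f -> (forall eta, `|f eta| <= K) -> 0 <= K ->
  nu.-integrable setT (EFin \o extend0 f).
Proof.
move=> lf fK K0; apply: measurable_bounded_integrable => //.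
- by rewrite (le_lt_trans (probability_le1 _ _))// ltry.
- exact: measurable_extend0.
- exists K; split; first exact: ger0_real.
  move=> x Kx eta _; exact: (le_trans (extend0_bounded fK K0 eta) (ltW Kx)).
Qed.

Lemma meanE f (K : R) : Lip f -> (forall eta, `|f eta| <= K) -> 0 <= K ->
  (\int[nu]_eta (extend0 f eta)%:E = (mean f)%:E)%E.
Proof.
move=> lf fK K0; rewrite /mean fineK//.
exact: (integrable_fin_num measurableT (integrable_extend0 lf fK K0)).
Qed.

Lemma expR_sub1_le (x : R) : 0 <= x -> expR x - 1 <= x * expR x.
Proof.
move=> x0; have := expR_ge1Dx (- x).
rewrite expRN -(ler_pM2r (expR_gt0 x)) mulVf ?gt_eqF ?expR_gt0//.
by rewrite mulrDl mul1r mulNr; lra.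
Qed.

(** The difference quotients at time 0 are dominated by a multiple of the norm,
    which is integrable. *)
Lemma mean_difference_quotient f (K : R) : Lip f -> (forall eta, `|f eta| <= K) -> 0 <= K ->
  (\int[nu]_eta (extend0 (generator p g f) eta)%:E = (mean (generator p g f))%:E)%E /\
  (mean (S n.+1%:R^-1 f) - mean f) * n.+1%:R @[n --> \oo] --> mean (generator p g f).
Proof.
move=> lf fK K0.
have [c c0 cP] := sg_bound S_semigroup.
have [l flip] := lf.
have t0 n : 0 <= n.+1%:R^-1 :> R by rewrite invr_ge0.
pose X : set (mconfig d) := Defs.finite_norm a.
pose q (n : nat) (eta : mconfig d) : \bar R :=
  ((extend0 (S n.+1%:R^-1 f) eta - extend0 f eta) * n.+1%:R)%:E.
pose k : R := l * (c * expR c).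
have mq n : measurable_fun X (q n).
  apply: measurable_funTS; apply/measurable_EFinP; apply: measurable_funM => //.
  by apply: measurable_funB; apply: measurable_extend0 => //;
    exact: (sg_Lip S_semigroup (t0 n) lf).
have qcvg eta : X eta -> q n eta @[n --> \oo] --> (extend0 (generator p g f) eta)%:E.
  move=> Xeta; apply: cvg_EFin.
    by apply: nearW.
  apply: (extend0_in (P := fun eta r =>
    (extend0 (S n.+1%:R^-1 f) eta - extend0 f eta) * n.+1%:R @[n --> \oo] --> r) Xeta).
  move=> zeta; rewrite extend0_val.
  have := (cvg_at_rightP _ _ _).1
    (@sg_derivative _ _ _ _ _ _ S_semigroup f zeta lf) (fun n => n.+1%:R^-1).
  have H : (forall n, 0 < n.+1%:R^-1 :> R) /\ n.+1%:R^-1 @[n --> \oo] --> (0 : R).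
    by split=> [n|]; [rewrite invr_gt0|exact: cvg_harmonic].
  move=> /(_ H); under eq_cvg do rewrite invrK.
  by under [X in X -> _]eq_cvg do rewrite -extend0_val.
have qle n eta : X eta -> (`|q n eta| <= cnorm a eta * k%:E)%E.
  move=> Xeta; pose s : state a := SigSub (mem_set Xeta).
  have := cP n.+1%:R^-1 f l s (t0 n) flip; rewrite -!extend0_val /= => H.
  rewrite /q /= normrM EFinM [`|n.+1%:R|]ger0_norm//.
  apply: le_trans (lee_wpmul2r _ H) _; first by rewrite lee_fin.
  rewrite -muleA -EFinM lee_wpmul2l ?cnorm_ge0// lee_fin /k.
  rewrite -mulrA ler_wpM2l ?(ltW flip.1)//.
  have h1 : n.+1%:R^-1 <= 1 :> R by rewrite invf_le1// ler1n.
  have ch0 : 0 <= c * n.+1%:R^-1 by rewrite mulr_ge0// ltW.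
  rewrite -ler_pdivlMr//; apply: le_trans (expR_sub1_le ch0) _.
  rewrite mulrAC ler_wpM2r ?invr_ge0// ler_wpM2l ?(ltW c0)//.
  by rewrite ler_expR ler_piMr// ltW.
have mgen : measurable_fun X (fun eta => (extend0 (generator p g f) eta)%:E).
  exact: emeasurable_fun_cvg mq qcvg.
have ig : nu.-integrable X (fun eta => cnorm a eta * k%:E)%E.
  apply: (integrableS measurableT mX) => //.
  apply: integrableZr => //.
  exact: (integrable_cnorm nu_transl nu_moment a0 a_sum).
have [igen _ icvg] := dominated_convergence mX mq mgen (aeW _ qcvg) ig
  (aeW _ (fun eta n => qle n eta)).
rewrite integral_extend0; have fgen := integrable_fin_num mX igen.
have gE : (mean (generator p g f))%:E =
    (\int[nu]_(eta in X) (extend0 (generator p g f) eta)%:E)%E.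
  by rewrite /mean integral_extend0 fineK.
split; first by rewrite gE.
move: icvg; rewrite -gE => /fine_cvgP[_].
suff E n : (mean (S n.+1%:R^-1 f) - mean f) * n.+1%:R =
    fine (\int[nu]_(eta in X) q n eta)%E.
  by rewrite (_ : (fun n => _ * _) = (fun n => fine (\int[nu]_(eta in X) q n eta)%E));
    last exact/funext.
have lS := sg_Lip S_semigroup (t0 n) lf.
have SK := semigroup_bounded (t0 n) lf fK.
have -> : (\int[nu]_(eta in X) q n eta = \int[nu]_eta q n eta)%E.
  rewrite integral_mkcond; apply: eq_integral => eta _.
  rewrite /patch; case: ifPn => // /negP; rewrite inE => nX.
  by rewrite /q !extend0_out// subrr mul0r.
have iS := integrable_extend0 lS SK K0.
have i_f := integrable_extend0 lf fK K0.
under eq_integral do rewrite /q EFinM EFinB.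
rewrite integralZr//; last exact: integrableB.
by rewrite integralB_EFin// (meanE lS SK K0) (meanE lf fK K0).
Qed.

(** By bounded convergence. *)
Lemma mean_semigroup_continuous f (K : R) (u : nat -> R) (t : R) : Lip f ->
  (forall eta, `|f eta| <= K) -> 0 <= K -> (forall n, 0 <= u n) ->
  u n @[n --> \oo] --> t -> mean (S (u n) f) @[n --> \oo] --> mean (S t f).
Proof.
move=> lf fK K0 u0 ut.
have t0 : 0 <= t.
  rewrite -(cvg_lim _ ut)//; apply: limr_ge; first by apply/cvg_ex; exists t.
  exact: nearW.
have iu s : 0 <= s -> nu.-integrable setT (EFin \o extend0 (S s f)).
  move=> s0; exact: (integrable_extend0 (sg_Lip S_semigroup s0 lf)
    (semigroup_bounded s0 lf fK) K0).
have muf s : 0 <= s -> measurable_fun setT (EFin \o extend0 (S s f)).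
  by move=> s0; case/integrableP: (iu s s0).
have pcvg eta : (extend0 (S (u n) f) eta)%:E @[n --> \oo] --> (extend0 (S t f) eta)%:E.
  suff H : extend0 (S (u n) f) eta @[n --> \oo] --> extend0 (S t f) eta.
    by apply: cvg_EFin; [exact: nearW|exact: H].
  have [X|nX] := pselect (Defs.finite_norm a eta); last first.
    rewrite (_ : (fun n => extend0 _ eta) = (fun=> 0)).
      by rewrite extend0_out//; exact: cvg_cst.
    by apply/funext => n; rewrite extend0_out.
  pose s : state a := SigSub (mem_set X).
  have E h : extend0 h eta = h s by rewrite -extend0_val.
  rewrite E (_ : (fun n => extend0 _ eta) = (fun n => S (u n) f s)); last first.
    by apply/funext => n; rewrite E.
  have ct := @sg_continuous _ _ _ _ _ _ S_semigroup f s lf t.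
  apply: (@cvg_comp _ _ _ u (fun r => S r f s) _ _ _ _ ct).
  rewrite /nbhs /= -nbhs_subspace_in; last by rewrite /= in_itv /= t0.
  move=> B /= /ut H.
  have {}H : \forall n \near \oo, `[0, +oo[%classic (u n) -> B (u n) by exact: H.
  change (\forall n \near \oo, B (u n)); apply: filterS H => n; apply.
  by rewrite /= in_itv /= u0.
have iK : nu.-integrable setT (fun=> K%:E) by exact: finite_measure_integrable_cst.
have bound : forall eta : mconfig d, forall n, setT eta ->
    (`|(EFin \o extend0 (S (u n) f)) eta| <= K%:E)%E.
  move=> eta n _ /=; rewrite lee_fin.
  exact: (extend0_bounded (semigroup_bounded (u0 n) lf fK) K0).
have [_ _] := dominated_convergence measurableT (fun n => muf (u n) (u0 n))
  (muf t t0) (aeW _ (fun eta _ => pcvg eta)) iK (aeW _ bound).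
have mE s : 0 <= s -> (\int[nu]_eta (extend0 (S s f) eta)%:E = (mean (S s f))%:E)%E.
  by move=> s0; exact: (meanE (sg_Lip S_semigroup s0 lf) (semigroup_bounded s0 lf fK) K0).
rewrite /= mE// => /fine_cvgP[_].
rewrite (_ : _ \o _ = (fun n => mean (S (u n) f)))//.
Qed.

Definition generator_mean_zero : Prop := forall f (K : R), Lip f ->
  (forall eta, `|f eta| <= K) -> 0 <= K ->
  (\int[nu]_eta (extend0 (generator p g f) eta)%:E = 0)%E.

(** The mean of S(t) f has the mean of the generator at S(t) f as right
    derivative, because S(t + h) = S(h) S(t). *)
Lemma invariant_generator : invariant_probability S nu <-> generator_mean_zero.
Proof.
split=> [[_ inv] f K lf fK K0|gen0].
  have [-> lim] := mean_difference_quotient lf fK K0.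
  congr EFin; rewrite -(cvg_lim _ lim)//.
  rewrite (_ : (fun n => _) = (fun=> 0)) ?lim_cst//.
  apply/funext => n.
  have n0 : 0 <= n.+1%:R^-1 :> R by rewrite invr_ge0.
  by rewrite /mean inv ?subrr ?mul0r//; exists K.
split; first exact: probability_finite_norm.
move=> f t lf [K fK] t0.
have X0 : Defs.finite_norm a (fun=> 0%N).
  by rewrite /Defs.finite_norm /= /cnorm esum1 ?ltry// => x _; rewrite mul0r.
have K0 : 0 <= K by exact: le_trans (normr_ge0 _) (fK (SigSub (mem_set X0))).
have bS s (s0 : 0 <= s) := semigroup_bounded s0 lf fK.
have lS s (s0 : 0 <= s) := sg_Lip S_semigroup s0 lf.
rewrite (meanE (lS t t0) (bS t t0) K0) (meanE lf fK K0); congr EFin.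
have <- : mean (S 0 f) = mean f.
  by rewrite /mean; congr (fine (integral _ _ _)); apply/funext => eta;
   congr (EFin (extend0 _ eta)); apply/funext => zeta;
   exact: (@sg_zero _ _ _ _ _ _ S_semigroup).
apply: (zero_right_derivative (phi := fun s => mean (S s f))) => //.
  by move=> u s u0 us; exact: mean_semigroup_continuous.
move=> s s0; have [E lim] := mean_difference_quotient (lS s s0) (bS s s0) K0.
have E0 : mean (generator p g (S s f)) = 0.
  by rewrite /mean (gen0 _ K (lS s s0) (bS s s0)).
move: lim; rewrite E0.
suff E1 n : S (s + n.+1%:R^-1) f = S n.+1%:R^-1 (S s f).
  by rewrite [X in _ -> X](_ : _ =
    ((mean (S n.+1%:R^-1 (S s f)) - mean (S s f)) * n.+1%:R @[n --> \oo] --> 0))//;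
    under eq_cvg do rewrite E1.
apply/funext => eta.
by rewrite addrC (sg_add S_semigroup)// invr_ge0.
Qed.

End invariance.

Section invariant_flux.
Context {R : realType} {d : nat} (p : site d -> site d -> R)
  (g : nat -> nat -> nat -> R) (C : R) (a : site d -> R)
  (S : R -> (state a -> R) -> (state a -> R))
  (nu : probability (mconfig d) R).
Hypotheses (p_prob : transition_probability p) (p_transl : translation_invariant p)
  (g_rates : mmp_rates g) (C0 : 0 <= C)
  (g_growth : forall k l : nat, (0 < k)%N ->
    (\sum_(1 <= j < k.+1) j%:R * g j k l <= C * (k + l)%:R)%R)
  (a0 : forall x, 0 < a x)
  (a_sum : (\esum_(x in [set: site d]) (a x)%:E < +oo)%E)
  (S_semigroup : markov_semigroup p g S)
  (nu_prod : product_probability nu)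
  (nu_transl : translation_invariant_probability nu)
  (nu_moment : finite_first_moment (marginal nu)).

Lemma invariant_flux : invariant_probability S nu <->
  forall (F : mconfig d -> R) (K l : R), measurable_fun setT F ->
    (forall eta, 0 <= F eta) -> (forall eta, F eta <= K) ->
    lipschitz_with l (fun zeta : state a => F (val zeta)) ->
    rsum setT (fun w : site d * site d => p w.1 w.2 * flux nu g F w.1 w.2) = 0.
Proof.
rewrite (invariant_generator a0 a_sum S_semigroup nu_transl nu_moment).
split=> [gen0 F K l mF F0 FK Fl|H f K lf fK K0].
  have [_ E] := integral_generator p_prob p_transl g_rates C0 g_growth a0 a_sum
    nu_prod nu_transl nu_moment mF F0 FK Fl.
  apply/eqP; rewrite -eqe -E; apply/eqP.
  apply: (gen0 _ K); first by exists l.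
    by move=> eta; rewrite ger0_norm.
  exact: le_trans (F0 (fun=> 0%N)) (FK _).
pose F (eta : mconfig d) : R := extend0 f eta + K.
have mF : measurable_fun setT F.
  by apply: measurable_funD => //; exact: measurable_extend0.
have F0 eta : 0 <= F eta.
  by have := extend0_bounded fK K0 eta; rewrite ler_norml /F => /andP[]; lra.
have FK eta : F eta <= K + K.
  by have := extend0_bounded fK K0 eta; rewrite ler_norml /F => /andP[]; lra.
have [l fl] := lf.
have Fl : lipschitz_with l (fun zeta : state a => F (val zeta)).
  case: fl => l0 fl; split=> // eta zeta; rewrite /F !extend0_val.
  by rewrite opprD addrACA subrr addr0.
have [_ E] := integral_generator p_prob p_transl g_rates C0 g_growth a0 a_sum
  nu_prod nu_transl nu_moment mF F0 FK Fl.
rewrite (H F _ _ mF F0 FK Fl) in E; rewrite -[RHS]/(0%:E) -E.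
apply: eq_integral => eta _; congr (EFin (extend0 _ eta)); apply/funext => zeta.
apply: eq_rsum => -[[x y] k] _ /=; rewrite /F !extend0_val.
by rewrite opprD addrACA subrr addr0.
Qed.

End invariant_flux.

(** * Cancellation over pairs of sites *)

Section kernel_rsum.
Context {R : realType} {d : nat} (p : site d -> site d -> R).
Hypotheses (p_prob : transition_probability p) (p_transl : translation_invariant p).

Lemma kernel_weighted_rsum (v : site d -> R) : rsummable setT v ->
  [/\ rsummable setT (fun w : site d * site d => p w.1 w.2 * v w.1),
      rsummable setT (fun w : site d * site d => p w.1 w.2 * v w.2),
      rsum setT (fun w : site d * site d => p w.1 w.2 * v w.1) = rsum setT v &
      rsum setT (fun w : site d * site d => p w.1 w.2 * v w.2) = rsum setT v].
Proof.
move=> sv.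
have p0 x y : 0 <= p x y by exact: kernel_ge0.
have m0 (x : R) : 0 <= Num.max x 0 by rewrite le_max lexx orbT.
have [Ep1 Ep2] := kernel_weighted_sum p_prob p_transl (fun x => m0 (v x)).
have [En1 En2] := kernel_weighted_sum p_prob p_transl (fun x => m0 (- v x)).
have [Ea1 Ea2] := kernel_weighted_sum p_prob p_transl (fun x => normr_ge0 (v x)).
have sp := rsummable_pos sv; have sn := rsummable_pos (rsummableN sv).
have H (q : site d * site d -> site d) :
    (\esum_(w in [set: site d * site d]) (p w.1 w.2 * `|v (q w)|)%:E =
     \esum_(x in [set: site d]) `|v x|%:E)%E ->
    (\esum_(w in [set: site d * site d]) (p w.1 w.2 * Num.max (v (q w)) 0)%:E =
     \esum_(x in [set: site d]) (Num.max (v x) 0)%:E)%E ->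
    (\esum_(w in [set: site d * site d]) (p w.1 w.2 * Num.max (- v (q w)) 0)%:E =
     \esum_(x in [set: site d]) (Num.max (- v x) 0)%:E)%E ->
    rsummable setT (fun w : site d * site d => p w.1 w.2 * v (q w)) /\
    rsum setT (fun w : site d * site d => p w.1 w.2 * v (q w)) = rsum setT v.
  move=> Ea Ep En; split.
    apply: (@le_rsummable _ _ _ _ (fun w => p w.1 w.2 * `|v (q w)|)).
      by move=> w _; rewrite normrM ger0_norm.
    by rewrite Ea; exact: sv.
  rewrite (rsumE sv) -Ep -En -rsum_diff ?Ep ?En//.
  - by apply: eq_rsum => w _; rewrite {1}(posneg (v (q w))) mulrBr.
  - by move=> w; rewrite mulr_ge0.
  - by move=> w; rewrite mulr_ge0.
have [? ?] := H fst Ea1 Ep1 En1.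
by have [? ?] := H snd Ea2 Ep2 En2.
Qed.

(** The bound keeps u within c * a of a constant, its limit at infinity. So u
    minus this constant is summable, and a summable function has the same sum
    against p whether it is read at the source or at the target of a step. *)
Lemma kernel_increments_rsum0 (a : site d -> R) (c : R) (u : site d -> R) :
  (forall x, 0 <= a x) ->
  (\esum_(x in [set: site d]) (a x)%:E < +oo)%E -> 0 <= c ->
  (forall x y, x != y -> `|u y - u x| <= c * (a x + a y)) ->
  rsum setT (fun w : site d * site d => p w.1 w.2 * (u w.2 - u w.1)) = 0.
Proof.
move=> a0 sa c0 uP.
have ule x y : u x - c * a x <= u y + c * a y.
  have [->|xy] := eqVneq x y; first by rewrite lerD2l ge0_cp// mulr_ge0.
  by have := uP x y xy; rewrite ler_norml mulrDr => /andP[]; lra.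
(* Every u x - c * a x is below every u y + c * a y; the supremum of the former
   is the limit of u. *)
pose A := [set u x - c * a x | x in [set: site d]].
have supA : has_sup A.
  split; first by exists (u 0 - c * a 0), 0.
  by exists (u 0 + c * a 0) => _ [x _ <-]; exact: ule.
pose v x := u x - sup A.
have v_le x : `|v x| <= c * a x.
  rewrite /v ler_norml; apply/andP; split.
    have : sup A <= u x + c * a x.
      by apply: ge_sup; [exact: supA.1|move=> _ [y _ <-]; exact: ule].
    lra.
  have : u x - c * a x <= sup A by apply: ub_le_sup; [exact: supA.2|exists x].
  lra.
have sv : rsummable setT v.
  apply: (le_rsummable (fun x _ => v_le x)).
  under eq_esum do rewrite EFinM.
  by rewrite esumZl// ?lte_mul_pinfty// => x; rewrite lee_fin.
have [s1 s2 E1 E2] := kernel_weighted_rsum sv.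
transitivity (rsum setT (fun w : site d * site d => p w.1 w.2 * v w.2 - p w.1 w.2 * v w.1)).
  by apply: eq_rsum => w _; rewrite -mulrBr /v opprB addrA subrK.
by rewrite rsumB// E1 E2 subrr.
Qed.

End kernel_rsum.

Section fluxes.
Context {R : realType} {d : nat} (g : nat -> nat -> nat -> R) (C : R)
  (nu : probability (mconfig d) R) (x0 y0 : site d).
Hypotheses (g_rates : mmp_rates g) (C0 : 0 <= C)
  (g_growth : forall k l : nat, (0 < k)%N ->
    (\sum_(1 <= j < k.+1) j%:R * g j k l <= C * (k + l)%:R)%R)
  (nu_prod : product_probability nu)
  (nu_transl : translation_invariant_probability nu)
  (nu_moment : finite_first_moment (marginal nu)) (xy0 : x0 != y0).
Local Notation mu := (marginal nu).
Local Notation net := (net_flow g mu).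
Local Notation mu_ge0 := (marginal_ge0 nu_transl).

Lemma summable_net_bounded (h : nat * nat -> R) (K : R) :
  (forall w, `|h w| <= K) -> rsummable setT (fun w : nat * nat => net w.1 w.2 * h w).
Proof.
move=> hK; have [si so] := esum_flow_lty nu_prod nu_transl nu_moment g_rates C0 g_growth xy0.
have K0 : 0 <= K by exact: le_trans (normr_ge0 _) (hK (0, 0)%N).
have i0 w : 0 <= inflow g mu w.1 w.2 by exact: inflow_ge0.
have o0 w : 0 <= outflow g mu w.1 w.2 by exact: outflow_ge0.
apply: (@le_rsummable _ _ _ _ (fun w => K * (inflow g mu w.1 w.2 + outflow g mu w.1 w.2))).
  move=> w _; rewrite normrM mulrC ler_pM// /net_flow.
  by rewrite (le_trans (ler_normB _ _))// !ger0_norm.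
under eq_esum do rewrite EFinM.
rewrite esumZl//; last by move=> w; rewrite lee_fin addr_ge0.
rewrite lte_mul_pinfty//; under eq_esum do rewrite EFinD.
by rewrite esumD ?lte_add_pinfty// => w _; rewrite lee_fin.
Qed.

Lemma summable_net : rsummable setT (fun w : nat * nat => net w.1 w.2).
Proof.
have := @summable_net_bounded (fun=> 1) 1; rewrite /rsummable.
by under eq_fun do rewrite mulr1; apply=> w; rewrite normr1.
Qed.

(** Each jump out of a pair of values leads into another one, so gains and
    losses balance. *)
Lemma rsum_net : rsum setT (fun w : nat * nat => net w.1 w.2) = 0.
Proof.
have [si so] := esum_flow_lty nu_prod nu_transl nu_moment g_rates C0 g_growth xy0.
rewrite rsum_diff//; last 2 first.
- by move=> w; exact: inflow_ge0.
- by move=> w; exact: outflow_ge0.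
have c1 k l : condexp nu (cst 1%R) x0 y0 k l = 1%R.
  by rewrite /condexp integral_const.
have m1 : measurable_fun setT (cst 1%R : mconfig d -> R) by exact: measurable_cst.
have := @integral_inflow _ _ nu nu_prod nu_transl g g_rates (cst 1%R) 1 m1
  (fun=> ler01) (fun=> lexx _) x0 y0 xy0.
have := @integral_outflow _ _ nu nu_prod nu_transl g g_rates (cst 1%R) 1 m1
  (fun=> ler01) (fun=> lexx _) x0 y0 xy0.
rewrite /= => -> E; apply/eqP; rewrite subr_eq0; apply/eqP; congr fine.
have E1 (h : nat -> nat -> R) : (\esum_(w in [set: nat * nat]) (h w.1 w.2)%:E =
    \esum_(w in [set: nat * nat]) (h w.1 w.2 * condexp nu (cst 1%R) x0 y0 w.1 w.2)%:E)%E.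
  by apply: eq_esum => w _; rewrite c1 mulr1.
by rewrite E1 (E1 (outflow g mu)) E.
Qed.

End fluxes.

Section conditions_on_net_flow.
Context {R : realType} (g : nat -> nat -> nat -> R) (mu : nat -> R).
Local Notation net := (net_flow g mu).

Lemma net_flow_Afun k l : mu k * mu l != 0 ->
  net k l = mu k * mu l * Afun g mu k l.
Proof.
move=> kl0; rewrite /Afun kl0 mulrBr /net_flow /inflow /outflow mulr_sumr.
congr (_ - _); last by rewrite mulrC.
by apply: eq_bigr => j _; rewrite mulrCA [mu k * mu l * _]mulrC divfK// mulrA.
Qed.

Lemma net_flow_inflow k l : mu k * mu l = 0 -> net k l = inflow g mu k l.
Proof. by move=> kl0; rewrite /net_flow /outflow kl0 mulr0 subr0. Qed.

Lemma net_flow_antisym : condition1 g mu -> condition2 g mu ->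
  forall k l, net k l = - net l k.
Proof.
move=> c1 c2 k l; have lk : mu l * mu k = mu k * mu l by rewrite mulrC.
have [kl0|kl0] := eqVneq (mu k * mu l) 0.
  by rewrite !net_flow_inflow ?lk// /inflow (c1 k l kl0) (c1 l k) ?oppr0// lk.
by rewrite !net_flow_Afun ?lk// (c2 k l) mulrN.
Qed.

Lemma net_flow_psi : condition1 g mu -> forall psi : nat -> R,
  (forall k l, mu k * mu l != 0 -> Afun g mu k l = psi l - psi k) ->
  forall k l, net k l = mu k * mu l * (psi l - psi k).
Proof.
move=> c1 psi psiP k l; have [kl0|kl0] := eqVneq (mu k * mu l) 0.
  by rewrite net_flow_inflow// kl0 mul0r /inflow; exact: c1.
by rewrite net_flow_Afun// psiP.
Qed.

End conditions_on_net_flow.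

Section bounded_fluxes.
Context {R : realType} {d : nat} (g : nat -> nat -> nat -> R) (C : R)
  (nu : probability (mconfig d) R) (x0 y0 : site d).
Hypotheses (g_rates : mmp_rates g) (C0 : 0 <= C)
  (g_growth : forall k l : nat, (0 < k)%N ->
    (\sum_(1 <= j < k.+1) j%:R * g j k l <= C * (k + l)%:R)%R)
  (nu_prod : product_probability nu)
  (nu_transl : translation_invariant_probability nu)
  (nu_moment : finite_first_moment (marginal nu)) (xy0 : x0 != y0).
Local Notation mu := (marginal nu).
Local Notation net := (net_flow g mu).
Local Notation mu_ge0 := (marginal_ge0 nu_transl).

Context (F : mconfig d -> R) (K : R).
Hypotheses (mF : measurable_fun setT F) (F0 : forall eta, 0 <= F eta)
  (FK : forall eta, F eta <= K).

Lemma upd_comm x y k l (eta : mconfig d) : x != y ->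
  upd x k (upd y l eta) = upd y l (upd x k eta).
Proof.
move=> xy; apply/funext => z; rewrite /upd.
by have [->|//] := eqVneq z x; rewrite (negbTE xy).
Qed.

Lemma condexp_comm x y k l : x != y -> condexp nu F x y k l = condexp nu F y x l k.
Proof.
move=> xy; rewrite /condexp; congr fine; apply: eq_integral => eta _.
by rewrite upd_comm.
Qed.

Lemma condexp_norm_le x y k l : `|condexp nu F x y k l| <= K.
Proof.
by rewrite ger0_norm ?(condexp_ge0 _ F0)// (condexp_le _ mF F0 FK).
Qed.

Lemma flux_antisym : (forall k l, net k l = - net l k) ->
  forall x y, flux nu g F y x = - flux nu g F x y.
Proof.
move=> anti x y; rewrite /flux eq_sym; case: eqVneq => [_|xy]; first by rewrite oppr0.
rewrite (@reindex_rsum R _ _ [set: nat * nat] _ (fun w => (w.2, w.1))); last first.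
  split=> //; first by move=> [k l] [k' l'] _ _ [-> ->].
  by move=> [k l] _; exists (l, k).
rewrite -rsumN; last first.
  apply: (summable_net_bounded g_rates C0 g_growth nu_prod nu_transl nu_moment xy0).
  by move=> w; exact: condexp_norm_le.
by apply: eq_rsum => -[k l] _ /=; rewrite (anti l k) mulNr (condexp_comm k l xy).
Qed.

Definition condexp1 x k : R := fine (\int[nu]_eta (F (upd x k eta))%:E).

Lemma condexp1E x k : ((condexp1 x k)%:E = \int[nu]_eta (F (upd x k eta))%:E)%E.
Proof.
by rewrite fineK// (integral_bounded_fin nu mF F0 FK (measurable_upd x k)).
Qed.

Lemma marginal_sum1 : (\esum_(n in [set: nat]) (mu n)%:E = 1)%E.
Proof.
have := integral_one_site nu_transl x0 (fun n => ler01 : 0 <= (fun=> 1%R : R) n).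
by rewrite integral_const; under eq_esum do rewrite mul1r.
Qed.

Lemma total_probability x (h : mconfig d -> mconfig d) : measurable_fun setT h ->
  (\esum_(k in [set: nat]) ((mu k)%:E * \int[nu]_eta (F (h (upd x k eta)))%:E) =
   \int[nu]_eta (F (h eta))%:E)%E.
Proof.
move=> mh; have mFh := measurableT_comp mF mh.
transitivity (\int[nu]_eta \esum_(k in [set: nat])
  ((eta x == k)%:R%:E * (F (h (upd x k eta)))%:E))%E.
  rewrite integral_esum.
  - apply: eq_esum => k _.
    rewrite (@integral_at_upd _ _ _ nu_prod nu_transl x k k (fun eta => (F (h eta))%:E))//.
      exact/measurable_EFinP.
    by move=> eta; rewrite lee_fin.
  - by move=> k eta; rewrite mule_ge0// lee_fin.
  - move=> k; apply: emeasurable_funM.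
      exact: (measurable_fun_at x (fun n => ((n == k)%:R : R)%:E)).
    by apply/measurable_EFinP; exact: (measurableT_comp mFh (measurable_upd x k)).
apply: eq_integral => eta _.
rewrite (esumID [set eta x])/=; last by move=> k _; rewrite mule_ge0// lee_fin.
rewrite setTI esum_set1; last by rewrite mule_ge0// lee_fin.
rewrite eqxx mul1e esum1 ?adde0.
  congr ((F (h _))%:E); apply/funext => z.
  by rewrite /upd; case: eqVneq => // ->.
by move=> k [_ /= /eqP kx]; rewrite eq_sym (negbTE kx) mul0e.
Qed.

Lemma total_condexp x y : x != y ->
  (forall k, rsum setT (fun l => mu l * condexp nu F x y k l) = condexp1 x k) /\
  (forall l, rsum setT (fun k => mu k * condexp nu F x y k l) = condexp1 y l).
Proof.
have H u v : u != v -> forall k : nat,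
    rsum setT (fun l => mu l * condexp nu F u v k l) = condexp1 u k.
  move=> uv k.
  have E : (\esum_(l in [set: nat]) (mu l * condexp nu F u v k l)%:E =
            (condexp1 u k)%:E)%E.
    rewrite condexp1E -(total_probability v (measurable_upd u k)).
    by apply: eq_esum => l _; rewrite EFinM (condexpE nu mF F0 FK).
  rewrite rsum_ge0 ?E ?ltry//.
  by move=> l; rewrite mulr_ge0 ?mu_ge0// condexp_ge0.
move=> xy; split; first exact: H.
move=> l; rewrite -(H y x); last by rewrite eq_sym.
by apply: eq_rsum => k _; rewrite (condexp_comm k l xy).
Qed.

(** The term in psi l (resp. psi k) of the flux only depends on the value at y
    (resp. x) once the value at the other site is averaged out. This requires
    mu * psi to be summable, as one row of the net flow shows. *)
Lemma flux_increment (psi : nat -> R) :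
  (forall k l, net k l = mu k * mu l * (psi l - psi k)) ->
  exists u : site d -> R, forall x y, x != y -> flux nu g F x y = u y - u x.
Proof.
move=> netE.
have smu : rsummable setT mu.
  by apply: ge0_rsummable; [exact: mu_ge0|rewrite marginal_sum1 ltry].
(* The marginal has total mass 1, so some value k0 has positive weight. *)
have [k0 k00] : exists k0, mu k0 != 0.
  apply: contrapT => /forallNP mu0.
  have := marginal_sum1; rewrite esum1 => [/esym/eqP|n _]; first by rewrite onee_eq0.
  by congr EFin; apply/eqP; have := mu0 n; case: eqP.
have spsi : rsummable setT (fun l => mu l * psi l).
  have [/(_ k0)/= s1 _ _] := rsum_pair
    (summable_net g_rates C0 g_growth nu_prod nu_transl nu_moment xy0).
  have := rsummableD (rsummableZ (mu k0)^-1 s1) (rsummableZ (psi k0) smu).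
  congr rsummable; apply/funext => l; rewrite netE !mulrA mulVf// mul1r.
  by rewrite mulrBr [psi k0 * _]mulrC subrK.
have K0 : 0 <= K by exact: le_trans (F0 (fun=> 0%N)) (FK _).
exists (fun x => rsum setT (fun k => mu k * psi k * condexp1 x k)) => x y xy.
rewrite /flux (negbTE xy).
have [T1 T2] := total_condexp xy.
have prod_summable (h : nat * nat -> nat * nat) : 
    rsummable setT (fun w : nat * nat =>
      mu w.1 * psi w.1 * (mu w.2 * condexp nu F x y (h w).1 (h w).2)).
  apply: (@le_rsummable _ _ _ _ (fun w => K * (`|mu w.1 * psi w.1| * mu w.2))).
    move=> w _; rewrite [X in X <= _]normrM [X in _ * X]normrM.
    rewrite mulrA [leLHS]mulrC ler_pM ?condexp_norm_le ?mulr_ge0//.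
    by rewrite [`|mu w.2|]ger0_norm ?mu_ge0.
  under eq_esum do rewrite EFinM.
  rewrite esumZl//; last by move=> w; rewrite lee_fin mulr_ge0 ?mu_ge0.
  rewrite lte_mul_pinfty//.
  rewrite (esum_pair (v := fun w => (`|mu w.1 * psi w.1| * mu w.2)%:E)); last first.
    by move=> w; rewrite lee_fin mulr_ge0 ?mu_ge0.
  rewrite (_ : esum _ _ = \esum_(i in [set: nat]) `|mu i * psi i|%:E)%E//.
  apply: eq_esum => i _ /=; under eq_esum do rewrite EFinM.
  by rewrite esumZl ?marginal_sum1 ?mule1// => l; rewrite lee_fin mu_ge0.
have [_ _ E1] := rsum_pair (prod_summable id).
have [_ _ E2] := rsum_pair (prod_summable (fun w => (w.2, w.1))).
have swap : set_bij [set: nat * nat] [set: nat * nat] (fun w => (w.2, w.1)).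
  split=> //; first by move=> [k l] [k' l'] _ _ [-> ->].
  by move=> [k l] _; exists (l, k).
have s2 : rsummable setT (fun w : nat * nat =>
    mu w.2 * psi w.2 * (mu w.1 * condexp nu F x y w.1 w.2)).
  have := prod_summable (fun w => (w.2, w.1)); rewrite /rsummable /summable.
  by rewrite (reindex_esum _ _ _ _ swap).
transitivity (rsum setT (fun w : nat * nat =>
    mu w.2 * psi w.2 * (mu w.1 * condexp nu F x y w.1 w.2) -
    mu w.1 * psi w.1 * (mu w.2 * condexp nu F x y w.1 w.2))).
  by apply: eq_rsum => w _; rewrite netE; ring.
have s1 := prod_summable id.
rewrite rsumB//.
rewrite (reindex_rsum _ swap) /= E1 E2 /=.
have smc (h : nat -> R) : (forall k, `|h k| <= K) -> rsummable setT (fun k => mu k * h k).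
  move=> hK; apply: (@le_rsummable _ _ _ _ (fun k => K * mu k)).
    by move=> k _; rewrite normrM mulrC ler_pM// ger0_norm// mu_ge0.
  under eq_esum do rewrite EFinM.
  by rewrite esumZl ?marginal_sum1 ?mule1 ?ltry// => k; rewrite lee_fin mu_ge0.
congr (_ - _); apply: eq_rsum => k _.
- by rewrite -T2 -rsumZ//; apply: smc => l; exact: condexp_norm_le.
- by rewrite -T1 -rsumZ//; apply: smc => l; exact: condexp_norm_le.
Qed.

End bounded_fluxes.

(** * Testing with two sites *)

Section test_functions.
Context {R : realType} {d : nat} (g : nat -> nat -> nat -> R) (C : R)
  (nu : probability (mconfig d) R) (x y : site d).
Hypotheses (g_rates : mmp_rates g) (C0 : 0 <= C)
  (g_growth : forall k l : nat, (0 < k)%N ->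
    (\sum_(1 <= j < k.+1) j%:R * g j k l <= C * (k + l)%:R)%R)
  (nu_prod : product_probability nu)
  (nu_transl : translation_invariant_probability nu)
  (nu_moment : finite_first_moment (marginal nu)) (xy : x != y).
Local Notation mu := (marginal nu).
Local Notation net := (net_flow g mu).
Local Notation mu_ge0 := (marginal_ge0 nu_transl).

Definition average (phi : nat -> R) : R :=
  fine (\esum_(n in [set: nat]) (phi n * mu n)%:E).

Definition net_at1 (phi : nat -> R) : R :=
  rsum setT (fun w : nat * nat => net w.1 w.2 * phi w.1).
Definition net_at2 (phi : nat -> R) : R :=
  rsum setT (fun w : nat * nat => net w.1 w.2 * phi w.2).
Definition net_at12 (phi chi : nat -> R) : R :=
  rsum setT (fun w : nat * nat => net w.1 w.2 * (phi w.1 * chi w.2)).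

Lemma integral_average z (c : R) (phi : nat -> R) : 0 <= c ->
  (forall n, 0 <= phi n <= 1) ->
  fine (\int[nu]_eta (c * phi (eta z))%:E)%E = c * average phi.
Proof.
move=> c0 phi01; have phi0 n : 0 <= phi n by case/andP: (phi01 n).
have phi1 n : phi n <= 1 by case/andP: (phi01 n).
under eq_integral do rewrite EFinM.
rewrite ge0_integralZl_EFin//; last 2 first.
- by move=> eta _; rewrite lee_fin.
- exact: (measurable_fun_at z (fun n => (phi n)%:E)).
rewrite (integral_one_site nu_transl z phi0) fineM//.
rewrite ge0_fin_numE; last by apply: esum_ge0 => n _; rewrite lee_fin mulr_ge0// mu_ge0.
apply: (@le_lt_trans _ _ (\esum_(n in [set: nat]) (mu n)%:E)%E).
  by apply: le_esum => n _; rewrite lee_fin ler_piMl// mu_ge0.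
by rewrite (marginal_sum1 x nu_transl) ltry.
Qed.

Context (phi chi : nat -> R).
Hypotheses (phi01 : forall n, 0 <= phi n <= 1) (chi01 : forall n, 0 <= chi n <= 1).

Definition test_function (eta : mconfig d) : R := phi (eta x) * chi (eta y).

Lemma measurable_test_function : measurable_fun setT test_function.
Proof. exact: (measurable_fun_at2 x y (fun k l => phi k * chi l)). Qed.

Let phi0 n : 0 <= phi n. Proof. by case/andP: (phi01 n). Qed.
Let chi0 n : 0 <= chi n. Proof. by case/andP: (chi01 n). Qed.
Let phi1 n : phi n <= 1. Proof. by case/andP: (phi01 n). Qed.
Let chi1 n : chi n <= 1. Proof. by case/andP: (chi01 n). Qed.

Lemma test_function_ge0 eta : 0 <= test_function eta.
Proof. by rewrite mulr_ge0. Qed.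

Lemma test_function_le1 eta : test_function eta <= 1.
Proof. by rewrite mulr_ile1. Qed.

Lemma lipschitz_test_function (a : site d -> R) : (forall z, 0 < a z) ->
  lipschitz_with ((a x)^-1 + (a y)^-1)
    (fun zeta : state a => test_function (val zeta)).
Proof.
move=> a0; split; first by rewrite addr_gt0// invr_gt0.
move=> eta zeta.
have one (h : nat -> R) (h01 : forall n, 0 <= h n <= 1) m n :
    `|h m - h n| <= `|m%:R - n%:R|.
  have [->|mn] := eqVneq m n; first by rewrite !subrr.
  apply: (@le_trans _ _ 1).
    rewrite ler_norml; have /andP[? ?] := h01 m; have /andP[? ?] := h01 n.
    by apply/andP; split; lra.
  rewrite -[m%:R]/(m%:Z%:~R) -[n%:R]/(n%:Z%:~R) -intrB -intr_norm ler1z.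
  by rewrite -gtz0_ge1 normr_gt0 subr_eq0 eqz_nat.
have D z : ((`|(val eta z)%:R - (val zeta z)%:R| * a z)%:E <=
    cdist a (val eta) (val zeta))%E.
  have n0 w : (0 <= (`|(val eta w)%:R - (val zeta w)%:R| * a w)%:E)%E.
    by rewrite lee_fin mulr_ge0// ltW.
  rewrite /cdist (esumID [set z])/=; last by move=> w _; exact: n0.
  rewrite setTI esum_set1; last exact: n0.
  by apply: leeDl; apply: esum_ge0 => w _; exact: n0.
have D0 : (0 <= cdist a (val eta) (val zeta))%E.
  by apply: esum_ge0 => w _; rewrite lee_fin mulr_ge0// ltW.
apply: (@le_trans _ _ (`|(val eta x)%:R - (val zeta x)%:R|%:E +
    `|(val eta y)%:R - (val zeta y)%:R|%:E)%E).
  rewrite -EFinD lee_fin /test_function.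
  rewrite (_ : _ - _ = (phi (val eta x) - phi (val zeta x)) * chi (val eta y) +
    phi (val zeta x) * (chi (val eta y) - chi (val zeta y))); last by ring.
  rewrite (le_trans (ler_normD _ _))// !normrM lerD//.
    by rewrite [`|chi _|]ger0_norm// (le_trans _ (one phi phi01 _ _))// ler_piMr.
  by rewrite [`|phi _|]ger0_norm// (le_trans _ (one chi chi01 _ _))// ler_piMl.
rewrite EFinD ge0_muleDl ?lee_fin ?invr_ge0 ?(ltW (a0 _))// leeD//.
  by rewrite lee_pdivlMl// muleC -EFinM.
by rewrite lee_pdivlMl// muleC -EFinM.
Qed.

Let A1 := average chi * net_at1 phi.
Let A2 := average chi * net_at2 phi.
Let B1 := average phi * net_at1 chi.
Let B2 := average phi * net_at2 chi.

(** When the jump involves one site of the support, the value at the other one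
    is averaged out; when it involves none, gains and losses balance. *)
Lemma flux_test_function u v : u != v ->
  flux nu g test_function u v =
  if u == x then (if v == y then net_at12 phi chi else A1)
  else if u == y then (if v == x then net_at12 chi phi else B1)
  else if v == x then A2 else if v == y then B2 else 0.
Proof.
move=> uv; rewrite /flux (negbTE uv).
have yx : (y == x) = false by rewrite eq_sym (negbTE xy).
have E k l : condexp nu test_function u v k l =
    fine (\int[nu]_eta
      (phi (if x == u then k else if x == v then l else eta x) *
       chi (if y == u then k else if y == v then l else eta y))%:E)%E by [].
have sum0 (h : nat -> nat -> R) (c : R) : (forall k l, h k l = c) ->
    rsum [set: nat * nat] (fun w => net w.1 w.2 * h w.1 w.2) = 0.
  move=> hc; rewrite (@eq_rsum _ _ _ _ (fun w => c * net w.1 w.2)); last first.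
    by move=> w _; rewrite hc mulrC.
  rewrite rsumZ.
    by rewrite (rsum_net g_rates C0 g_growth nu_prod nu_transl nu_moment xy) mulr0.
  exact: (summable_net g_rates C0 g_growth nu_prod nu_transl nu_moment xy).
have sumZ (h f : nat * nat -> R) (c : R) : (forall w, h w = f w * c) ->
    (forall w, 0 <= f w <= 1) ->
    rsum [set: nat * nat] (fun w => net w.1 w.2 * h w) =
    c * rsum setT (fun w => net w.1 w.2 * f w).
  move=> hf f01; rewrite -rsumZ; last first.
    apply: (summable_net_bounded g_rates C0 g_growth nu_prod nu_transl nu_moment xy (K := 1)).
    by move=> w; have /andP[? ?] := f01 w; rewrite ger0_norm.
  by apply: eq_rsum => w _; rewrite hf; ring.
have [ux|ux] := eqVneq u x.
  have xv : (x == v) = false by rewrite -ux (negbTE uv).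
  have [vy|vy] := eqVneq v y.
    apply: eq_rsum => w _; rewrite E ux vy eqxx yx eqxx.
    by rewrite integral_const.
  apply: (sumZ _ (fun w => phi w.1)) => // w; rewrite E ux eqxx yx (eq_sym y v) (negbTE vy).
  exact: integral_average.
have [uy|uy] := eqVneq u y.
  have [vx|vx] := eqVneq v x.
    apply: eq_rsum => w _; rewrite E uy vx eqxx (negbTE xy) eqxx.
    by rewrite integral_const /= [phi _ * _]mulrC.
  apply: (sumZ _ (fun w => chi w.1)) => // w.
  rewrite E uy eqxx (negbTE xy) (eq_sym x v) (negbTE vx).
  rewrite -(integral_average x)//; congr fine; apply: eq_integral => eta _.
  by rewrite mulrC.
have [vx|vx] := eqVneq v x.
  apply: (sumZ _ (fun w => phi w.2)) => // w.
  rewrite E vx (eq_sym x u) (negbTE ux) eqxx (eq_sym y u) (negbTE uy) yx.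
  exact: integral_average.
have [vy|vy] := eqVneq v y.
  apply: (sumZ _ (fun w => chi w.2)) => // w.
  rewrite E vy (eq_sym x u) (negbTE ux) (negbTE xy) (eq_sym y u) (negbTE uy) eqxx.
  rewrite -(integral_average x)//; congr fine; apply: eq_integral => eta _.
  by rewrite mulrC.
apply: (sum0 _ (fine (\int[nu]_eta (phi (eta x) * chi (eta y))%:E)%E)) => k l.
by rewrite E (eq_sym x u) (negbTE ux) (eq_sym x v) (negbTE vx)
  (eq_sym y u) (negbTE uy) (eq_sym y v) (negbTE vy).
Qed.

(** Only pairs of sites that meet the support of the test function contribute.
    Since p is stochastic in each variable, the jumps from x, to x, from y and
    to y would each have total weight 1; what remains corrects for the pairs
    (x, y) and (y, x), counted twice, and for the null jumps. *)
Lemma rsum_flux_test_function (p : site d -> site d -> R) :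
  transition_probability p -> translation_invariant p ->
  rsum setT (fun w : site d * site d => p w.1 w.2 * flux nu g test_function w.1 w.2) =
  (1 - p 0 0) * (A1 + A2 + B1 + B2) +
  p x y * (net_at12 phi chi - A1 - B2) + p y x * (net_at12 chi phi - A2 - B1).
Proof.
move=> p_prob p_transl.
have pxx z : p z z = p 0 0 by rewrite -(p_transl 0 0 z) add0r.
pose has (u : site d * site d -> R) (s : R) := rsummable setT u /\ rsum setT u = s.
have hasD u v s t : has u s -> has v t -> has (fun w => u w + v w) (s + t).
  by move=> [su <-] [sv <-]; split; [exact: rsummableD|rewrite rsumD].
have has1 z c : has (fun w => p w.1 w.2 * ((w.1 == z)%:R * c)) c.
  have [s E] := rsum_single z c.
  by have [? _ + _] := kernel_weighted_rsum p_prob p_transl s; rewrite E.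
have has2 z c : has (fun w => p w.1 w.2 * ((w.2 == z)%:R * c)) c.
  have [s E] := rsum_single z c.
  by have [_ ? _ +] := kernel_weighted_rsum p_prob p_transl s; rewrite E.
have hasP z c : has (fun w => (w == z)%:R * c) c by exact: rsum_single.
have [_ E] := hasD _ _ _ _ (hasD _ _ _ _ (hasD _ _ _ _ (has1 x A1) (has2 x A2))
    (hasD _ _ _ _ (has1 y B1) (has2 y B2)))
  (hasD _ _ _ _
    (hasD _ _ _ _ (hasP (x, y) (p x y * (net_at12 phi chi - A1 - B2)))
      (hasP (y, x) (p y x * (net_at12 chi phi - A2 - B1))))
    (hasD _ _ _ _ (hasP (x, x) (- (p 0 0 * (A1 + A2)))) (hasP (y, y) (- (p 0 0 * (B1 + B2)))))).
transitivity (A1 + A2 + (B1 + B2) +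
     (p x y * (net_at12 phi chi - A1 - B2) + p y x * (net_at12 chi phi - A2 - B1) +
      (- (p 0 0 * (A1 + A2)) - p 0 0 * (B1 + B2)))); last by ring.
rewrite -E; apply: eq_rsum => -[u v] _ /=; rewrite !xpair_eqE.
have yx : (y == x) = false by rewrite eq_sym (negbTE xy).
have [<-|uv] := eqVneq u v.
  rewrite /flux eqxx pxx.
  have [->|ux] := eqVneq u x; first by rewrite (negbTE xy) /=; ring.
  by have [_|_] := eqVneq u y; rewrite /=; ring.
rewrite (flux_test_function uv).
have [ux|ux] := eqVneq u x.
  rewrite ux in uv *; have vx : (v == x) = false by rewrite eq_sym (negbTE uv).
  rewrite (negbTE xy) vx /=.
  by have [->|vy] := eqVneq v y; rewrite /=; ring.
have [uy|uy] := eqVneq u y.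
  rewrite uy in uv *; have [->|vx] := eqVneq v x; rewrite ?(negbTE xy) /=; first by ring.
  by have -> : (v == y) = false; [rewrite eq_sym (negbTE uv)|rewrite /=; ring].
have [->|vx] := eqVneq v x; first by rewrite (negbTE xy) /=; ring.
by have [->|vy] := eqVneq v y; rewrite /=; ring.
Qed.

End test_functions.

(** If no jump led to a different site, neither would any path. *)
Lemma irreducible_jump {R : realType} {d : nat} (p : site d -> site d -> R) :
  (0 < d)%N -> transition_probability p -> translation_invariant p ->
  irreducible p -> p 0 0 < 1 /\ exists x y, x != y /\ 0 < p x y.
Proof.
move=> d0 p_prob p_transl p_irred.
have p0 x y : 0 <= p x y by exact: kernel_ge0.
have [x [y [xy pxy]]] : exists x y, x != y /\ 0 < p x y.
  apply: contrapT => noxy.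
  have pE x y : x != y -> p x y = 0.
    move=> xy; apply/eqP; rewrite eq_le p0 andbT leNgt; apply/negP => pxy.
    by apply: noxy; exists x, y.
  have sE n x y : x != y -> step_probability p n x y = 0%E.
    elim: n x y => [|n IH] x y xy /=; first by rewrite (negbTE xy).
    apply: esum1 => z _; have [<-|xz] := eqVneq x z.
      by rewrite IH ?mule0.
    by rewrite pE// mul0e.
  pose z : site d := const_mx 1.
  have z0 : 0 != z.
    apply/eqP => /matrixP /(_ 0 (Ordinal d0)).
    by rewrite !mxE.
  by have [n] := p_irred 0 z; rewrite sE// ltxx.
split; last by exists x, y.
have : (\esum_(z in [set x; y]) (p x z)%:E <= 1)%E.
  rewrite -(kernel_row_sum p_prob x) [leRHS](esumID [set x; y])/=; last first.
    by move=> z _; rewrite lee_fin.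
  by rewrite setTI leeDl// esum_ge0// => z _; rewrite lee_fin.
rewrite (esumID [set x])/=; last by move=> z _; rewrite lee_fin.
rewrite (_ : [set x; y] `&` [set x] = [set x]); last first.
  by apply/seteqP; split=> z /=; [case|move=> ->; split=> //; left].
rewrite (_ : [set x; y] `&` [set~ x] = [set y]); last first.
  apply/seteqP; split=> z /=; first by case=> -[].
  by move=> ->; split; [right|apply/eqP; rewrite eq_sym].
rewrite !esum_set1 ?lee_fin// => pxx1.
by rewrite -(p_transl 0 0 x) add0r; move: pxx1 pxy; rewrite /= => *; lra.
Qed.

Section necessity.
Context {R : realType} {d : nat} (p : site d -> site d -> R)
  (g : nat -> nat -> nat -> R) (C : R) (a : site d -> R)
  (S : R -> (state a -> R) -> (state a -> R))
  (nu : probability (mconfig d) R).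
Hypotheses (p_prob : transition_probability p) (p_transl : translation_invariant p)
  (p00 : p 0 0 < 1) (g_rates : mmp_rates g) (C0 : 0 <= C)
  (g_growth : forall k l : nat, (0 < k)%N ->
    (\sum_(1 <= j < k.+1) j%:R * g j k l <= C * (k + l)%:R)%R)
  (a0 : forall x, 0 < a x)
  (a_sum : (\esum_(x in [set: site d]) (a x)%:E < +oo)%E)
  (S_semigroup : markov_semigroup p g S)
  (nu_prod : product_probability nu)
  (nu_transl : translation_invariant_probability nu)
  (nu_moment : finite_first_moment (marginal nu))
  (nu_inv : invariant_probability S nu).
Local Notation mu := (marginal nu).
Local Notation net := (net_flow g mu).

Let at_ (k n : nat) : R := (n == k)%:R.

Let at01 k n : 0 <= at_ k n <= 1.
Proof. by rewrite /at_; case: (n == k); rewrite ?lexx ?ler01. Qed.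

Let cst01 (n : nat) : 0 <= (fun=> 1 : R) n <= 1. Proof. by rewrite ler01 lexx. Qed.

(** Invariance is tested on the event that x and y carry k and l particles. *)
Lemma net_flow_relation x y k l : x != y ->
  p x y * net k l + p y x * net l k =
  (p x y - p y x) * (mu l * net_at1 g nu (at_ k) - mu k * net_at1 g nu (at_ l)).
Proof.
move=> xy.
have snet := summable_net g_rates C0 g_growth nu_prod nu_transl nu_moment xy.
have avg1 : average nu (fun=> 1) = 1.
  rewrite /average; under eq_esum do rewrite mul1r.
  by rewrite (marginal_sum1 x nu_transl).
have avgk i : average nu (at_ i) = mu i.
  have [s E] := rsum_single i (mu i).
  have m0 n : 0 <= (n == i)%:R * mu i by rewrite mulr_ge0// marginal_ge0.
  rewrite /average -[RHS]E rsum_ge0//; last first.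
    by move: s; rewrite /rsummable /summable; apply: le_lt_trans;
      apply: le_esum => n _; rewrite lee_fin ler_norm.
  congr fine; apply: eq_esum => n _; rewrite /at_.
  by have [->|_] := eqVneq n i; rewrite ?mul0r.
have net1 h : (forall w : nat * nat, h w = 1) ->
    rsum setT (fun w : nat * nat => net w.1 w.2 * h w) = 0.
  move=> h1; rewrite -[RHS](rsum_net g_rates C0 g_growth nu_prod nu_transl nu_moment xy).
  by apply: eq_rsum => w _; rewrite h1 mulr1.
have netk i j : net_at12 g nu (at_ i) (at_ j) = net i j.
  have [_ E] := rsum_single ((i, j) : nat * nat) (net i j).
  rewrite /net_at12 -[RHS]E; apply: eq_rsum => -[m n] _ /=.
  rewrite /at_ xpair_eqE mulrC.
  by have [->|_] := eqVneq m i; have [->|_] := eqVneq n j; rewrite /= ?(mul1r, mul0r, mulr0).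
have test phi chi (phi01 : forall n, 0 <= phi n <= 1) (chi01 : forall n, 0 <= chi n <= 1) :=
  (invariant_flux p_prob p_transl g_rates C0 g_growth a0 a_sum S_semigroup
    nu_prod nu_transl nu_moment).1 nu_inv _ _ _ (measurable_test_function x y phi chi)
    (test_function_ge0 x y phi01 chi01) (test_function_le1 x y phi01 chi01)
    (lipschitz_test_function x y phi01 chi01 a0).
(* Testing the single value at x: at each site, what is gained as source of
   the jumps is lost as target. *)
have anti i : net_at2 g nu (at_ i) = - net_at1 g nu (at_ i).
  have := test _ _ (at01 i) cst01.
  rewrite (rsum_flux_test_function g_rates C0 g_growth nu_prod nu_transl nu_moment xy
    (at01 i) cst01 p_prob p_transl) avg1.
  rewrite [net_at1 _ _ (fun=> 1)]net1// [net_at2 _ _ (fun=> 1)]net1//.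
  rewrite (_ : net_at12 g nu (at_ i) (fun=> 1) = net_at1 g nu (at_ i)); last first.
    by apply: eq_rsum => w _; rewrite mulr1.
  rewrite (_ : net_at12 g nu (fun=> 1) (at_ i) = net_at2 g nu (at_ i)); last first.
    by apply: eq_rsum => w _; rewrite mul1r.
  rewrite !mulr0 !mul1r !addr0 !subr0 !subrr !mulr0 !addr0 => /eqP.
  rewrite mulf_eq0 subr_eq0 gt_eqF//= addrC addr_eq0 => /eqP ->.
  by [].
have := test _ _ (at01 k) (at01 l).
rewrite (rsum_flux_test_function g_rates C0 g_growth nu_prod nu_transl nu_moment xy
    (at01 k) (at01 l) p_prob p_transl) !avgk !netk !anti => E.
apply/eqP; rewrite -subr_eq0 -E; apply/eqP; ring.
Qed.

End necessity.

(** * Characterization of the invariant product measures *)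

Theorem theorem3p1 (R : realType) (d : nat) (d_gt0 : (0 < d)%N)
    (p : site d -> site d -> R)
    (p_prob : transition_probability p)
    (p_transl : translation_invariant p)
    (p_irred : irreducible p)
    (g : nat -> nat -> nat -> R)
    (g_rates : mmp_rates g)
    (g_growth : linear_growth g)
    (a : site d -> R) (a_weight : weight p a)
    (S : R -> (state a -> R) -> (state a -> R))
    (S_semigroup : markov_semigroup p g S)
    (nu : probability (mconfig d) R)
    (nu_prod : product_probability nu)
    (nu_transl : translation_invariant_probability nu)
    (nu_moment : finite_first_moment (marginal nu)) :
  [/\ invariant_probability S nu ->
        condition1 g (marginal nu) /\ condition2 g (marginal nu),
      symmetric_kernel p ->
        condition1 g (marginal nu) /\ condition2 g (marginal nu) ->
        invariant_probability S nu &
      ~ symmetric_kernel p ->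
        (invariant_probability S nu <->
         condition1 g (marginal nu) /\ condition3 g (marginal nu))].
Proof.
have [C /ltW C0 growth] := g_growth.
have [a0 _ a_sum] := a_weight.
have [p00 [x0 [y0 [xy0 pxy0]]]] := irreducible_jump d_gt0 p_prob p_transl p_irred.
pose net := net_flow g (marginal nu); pose mu := marginal nu.
have relation (inv : invariant_probability S nu) := net_flow_relation p_prob p_transl
  p00 g_rates C0 growth a0 a_sum S_semigroup nu_prod nu_transl nu_moment inv.
have anti : invariant_probability S nu -> forall k l, net k l = - net l k.
  (* Exchanging k and l changes the sign of the right-hand side of the
     relation. *)
  move=> /relation rel k l; have := rel x0 y0 k l xy0; have := rel x0 y0 l k xy0.
  rewrite -/net => r1 r2.
  have : (p x0 y0 + p y0 x0) * (net k l + net l k) = 0.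
    rewrite (_ : _ * _ = (p x0 y0 * net k l + p y0 x0 * net l k) +
      (p x0 y0 * net l k + p y0 x0 * net k l)); last by ring.
    by rewrite r1 r2; ring.
  have pp : 0 < p x0 y0 + p y0 x0 by rewrite ltr_pwDl// kernel_ge0.
  by move/eqP; rewrite mulf_eq0 (gt_eqF pp)/= addr_eq0 => /eqP.
have cond1 : invariant_probability S nu -> condition1 g mu.
  (* Where mu k * mu l vanishes there is no loss, so the net flow is
     nonnegative both at (k, l) and at (l, k). *)
  move=> /anti an k l kl0; apply: le_anti; apply/andP; split; last first.
    exact: (inflow_ge0 nu_transl g_rates k l).
  have := an k l; rewrite /net net_flow_inflow// net_flow_inflow; last by rewrite mulrC.
  rewrite -/(inflow g mu k l) => ->.
  by rewrite oppr_le0 (inflow_ge0 nu_transl g_rates l k).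
have cond2 : invariant_probability S nu -> condition2 g mu.
  move=> /anti an k l; have lk : mu l * mu k = mu k * mu l by rewrite mulrC.
  have [kl0|kl0] := eqVneq (mu k * mu l) 0.
    by rewrite /Afun lk kl0 eqxx oppr0.
  apply: (mulfI kl0); have := an k l.
  by rewrite /net !net_flow_Afun -?/mu ?lk// mulrN.
have summable_flux F K l mF F0 FK Fl := (@integral_generator _ _ p g C a nu p_prob p_transl
  g_rates C0 growth a0 a_sum nu_prod nu_transl nu_moment F K l mF F0 FK Fl).1.
split.
- by move=> inv; split; [exact: cond1|exact: cond2].
- move=> p_sym [c1 c2].
  apply/(invariant_flux p_prob p_transl g_rates C0 growth a0 a_sum S_semigroup
    nu_prod nu_transl nu_moment) => F K l mF F0 FK Fl.
  apply: rsum_swap_antisym; first exact: (summable_flux F K l).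
  move=> x y /=; rewrite (flux_antisym g_rates C0 growth nu_prod nu_transl nu_moment xy0
    mF F0 FK (net_flow_antisym c1 c2)).
  by rewrite (p_sym y x) mulrN.
- move=> p_asym; split=> [inv|[c1 [psi psiP]]].
    split; first exact: cond1.
    have [x [y pxy]] : exists x y, p x y != p y x.
      apply: contrapT => nopxy; apply: p_asym => x y.
      by apply/eqP; apply: contrapT => /negP pxy; apply: nopxy; exists x, y.
    have xy : x != y by apply: contra_neq pxy => ->.
    exists (fun k => - (net_at1 g nu (fun n => (n == k)%:R) / mu k)) => k l kl0.
    have := relation inv x y k l xy; rewrite -/net -/mu (anti inv l k).
    rewrite mulrN -mulrBl => /mulfI; rewrite subr_eq0 => /(_ pxy).
    rewrite /net net_flow_Afun// -/mu => E.
    move: (kl0); rewrite mulf_eq0 negb_or => /andP[k0 l0].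
    apply: (mulfI kl0); rewrite E /mu; field.
    by rewrite -/mu k0 l0.
  apply/(invariant_flux p_prob p_transl g_rates C0 growth a0 a_sum S_semigroup
    nu_prod nu_transl nu_moment) => F K l mF F0 FK Fl.
  have [u uP] := flux_increment g_rates C0 growth nu_prod nu_transl nu_moment xy0
    mF F0 FK (net_flow_psi c1 psiP).
  transitivity (rsum setT (fun w : site d * site d => p w.1 w.2 * (u w.2 - u w.1))).
    apply: eq_rsum => -[x y] _ /=; congr (_ * _).
    by have [->|xy] := eqVneq x y; [rewrite /flux eqxx subrr|exact: uP].
  have m1 := first_moment_ge0 nu_transl.
  apply: (@kernel_increments_rsum0 _ _ _ p_prob p_transl a
    (l * (C * (first_moment nu + first_moment nu)))) => //.
  + by move=> x; exact: ltW.
  + by rewrite mulr_ge0 ?(ltW Fl.1)// mulr_ge0// addr_ge0.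
  move=> x y xy; rewrite -uP//.
  apply: le_trans (flux_le g_rates C0 growth a0 a_sum nu_prod nu_transl nu_moment
    mF F0 FK Fl x y) _.
  by rewrite mulrAC.
Qed.
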